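(* Let $G$ be a non-precompact abelian metrizable topological group, let $X$ be a $G$-Tychonoff first countable space, and let $H$ be a subgroup of $G^X$ (with the pointwise topology) containing $B_1(X,G)$. Then: (A) $H$ is a $\kappa$-Fréchet–Urysohn space and hence is an Ascoli space. (B) The following assertions are equivalent: (i) $X$ is countable; (ii) $H$ is a metrizable space and $H=G^X$; (iii) $H$ has countable tightness; (iv) $H$ has countable $cs^\ast$-character; (v) $H$ is a $\sigma$-space; (vi) $H$ is a $k$-space. If in addition $B_2(X,G)\subseteq H$, then (i)–(vi) are equivalent to (vii) $H$ is a normal space. (C) If $B_2(X,G)\subseteq H$, then $H$ is a Lindelöf space if and only if $X$ is countable and $G$ is separable. (D) $H$ is Čech-complete if and only if $X$ is countable and $G$ is complete.
   Context: All topological spaces are Tychonoff (completely regular Hausdorff); countable means finite or countably infinite. For Tychonoff spaces $X,Y$, $C(X,Y)$ is the set of continuous functions $X\to Y$. $X$ is $Y$-Tychonoff if for every closed $A\subseteq X$, every $x\in X\setminus A$ and every two distinct points $y,z\in Y$ there is $f\in C(X,Y)$ with $f(x)=y$ and $f(a)=z$ for all $a\in A$. Baire classes: $B_0(X,Y)=C(X,Y)$; for a countable ordinal $\alpha\geq 1$, $B_\alpha(X,Y)$ is the set of all $f:X\to Y$ that are pointwise limits of sequences from $\bigcup_{i<\alpha}B_i(X,Y)$. All these sets carry the pointwise topology, i.e. the topology induced from the product $Y^X$. A topological group $G$ is precompact if for every neighborhood $U$ of the identity finitely many translates of $U$ cover $G$. $G$ complete means complete as a topological group (in its group uniformity). A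 space $Z$ is: - $\kappa$-Fréchet–Urysohn if for every open $U\subseteq Z$ and every $x\in\overline{U}$ there is a sequence in $U$ converging to $x$; - Ascoli (for $Z$ Tychonoff) if every compact subset $\mathcal K$ of $C_k(Z)$ (the space of continuous real functions on $Z$ with the compact-open topology) is evenly continuous, i.e. the map $\mathcal K\times Z\to\mathbb R$, $(f,x)\mapsto f(x)$, is continuous; - of countable tightness if whenever $A\subseteq Z$ and $x\in\overline A$, then $x\in\overline B$ for some countable $B\subseteq A$; - of countable $cs^\ast$-character if for each $x\in Z$ there is a countable family $\mathcal N_x$ of subsets of $Z$ such that for each sequence $(x_n)_{n\in\mathbb N}$ in $Z$ converging to $x$ and each neighborhood $O_x$ of $x$ there is $N\in\mathcal N_x$ with $x\in N\subseteq O_x$ and $\{n\in\mathbb N: x_n\in N\}$ infinite; - a $\sigma$-space if it has a $\sigma$-locally finite network (a network is a family $\mathcal N$ of subsets such that for every point $x$ and neighborhood $O$ of $x$ there is $N\in\mathcal N$ with $x\in N\subseteq O$; $\sigma$-locally finite means a countable union of locally finite families); - a $k$-space if for each non-closed $A\subseteq Z$ there is a compact $K\subseteq Z$ such that $K\cap A$ is not closed in $K$; - Čech-complete if it is a $G_\delta$-subset of some (equivalently, every) Hausdorff compactification. *)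

(* Defs.v *)
From HB Require Import structures.
From mathcomp Require Import all_boot all_order all_algebra.
From mathcomp Require Import all_classical all_reals all_analysis.
From mathcomp Require Import borel_hierarchy.

Set Implicit Arguments.
Unset Strict Implicit.
Unset Printing Implicit Defensive.

Import Order.TTheory GRing.Theory Num.Theory.
Import numFieldNormedType.Exports.

Local Open Scope classical_set_scope.
Local Open Scope ring_scope.

Section TopologicalProperties.
Variable Z : topologicalType.

Definition tychonoff_space :=
  hausdorff_space Z /\ completely_regular_space Z.

Definition first_countable := forall x : Z,
  exists B : set (set Z),
    [/\ countable B, B `<=` nbhs x &
        forall U, nbhs x U -> exists2 V, B V & V `<=` U].

Definition metrizable (R : realType) :=
  exists d : Z -> Z -> R,
    [/\ forall x y, d x y = 0 <-> x = y,
        forall x y, d x y = d y x,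
        forall x y z, d x z <= d x y + d y z &
        forall x, nbhs x = nbhs_ball_ (fun y e => [set z | d y z < e]) x].

Definition separable_space := exists2 D : set Z, countable D & dense D.

Definition lindelof_space := forall C : set (set Z),
  C `<=` open -> \bigcup_(U in C) U = [set: Z] ->
  exists C' : set (set Z),
    [/\ countable C', C' `<=` C & \bigcup_(U in C') U = [set: Z]].

Definition kappa_frechet_urysohn := forall (U : set Z) (x : Z),
  open U -> closure U x ->
  exists u : nat -> Z, (forall n, U (u n)) /\ u @ \oo --> x.

Definition countable_tightness := forall (A : set Z) (x : Z),
  closure A x -> exists B : set Z, [/\ countable B, B `<=` A & closure B x].

Definition countable_cs_star_character := forall x : Z,
  exists2 N : set (set Z), countable N &
    forall (u : nat -> Z) (O : set Z), u @ \oo --> x -> nbhs x O ->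
      exists A : set Z,
        [/\ N A, A x, A `<=` O & infinite_set [set n | A (u n)]].

Definition network (N : set (set Z)) := forall (x : Z) (O : set Z),
  nbhs x O -> exists A : set Z, [/\ N A, A x & A `<=` O].

Definition locally_finite (F : set (set Z)) := forall x : Z,
  exists2 O : set Z, nbhs x O & finite_set [set A | F A /\ A `&` O !=set0].

Definition sigma_space := exists2 F : nat -> set (set Z),
  forall n, locally_finite (F n) & network (\bigcup_n F n).

Definition k_space := forall A : set Z, ~ closed A ->
  exists2 K : set Z, compact K & ~ closed (K `&` A : set (subspace K)).

Definition topological_embedding (T : topologicalType) (e : Z -> T) :=
  injective e /\ @open Z = [set e @^-1` V | V in @open T].

Definition cech_complete := exists (K : topologicalType) (e : Z -> K),
  [/\ compact [set: K], hausdorff_space K, topological_embedding e,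
      dense (range e) & Gdelta (range e)].

(* The library puts the compact-open topology on all functions Z -> R; C_k(Z)
   is its subspace of continuous functions. *)
Definition Ck (R : realType) : set {compact-open, Z -> R} :=
  [set f | continuous (f : Z -> R)].

Definition ascoli_space (R : realType) := forall K : set (set_type (@Ck R)),
  compact K ->
  {within K `*` [set: Z],
    continuous (fun p : set_type (@Ck R) * Z => \val p.1 p.2 : R)}.

End TopologicalProperties.

Definition tychonoff_wrt (Y X : topologicalType) :=
  forall (A : set X) (x : X) (y z : Y), closed A -> ~ A x -> y <> z ->
  exists f : X -> Y, [/\ continuous f, f x = y & forall a, A a -> f a = z].

Section BaireClasses.
Variables X Y : topologicalType.

Definition pointwise_limits (A : set (X -> Y)) : set (X -> Y) :=
  [set f | exists2 u : nat -> X -> Y, forall n, A (u n) &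
             forall x, (u n x @[n --> \oo] --> f x)].

(* Only finite levels are defined: baire_upto n is the union of the classes
   B_i with i <= n, and baire_class n is B_n. *)
Fixpoint baire_upto (n : nat) : set (X -> Y) :=
  if n is m.+1 then baire_upto m `|` pointwise_limits (baire_upto m)
  else [set f | continuous f].

Definition baire_class (n : nat) : set (X -> Y) :=
  if n is m.+1 then pointwise_limits (baire_upto m)
  else [set f | continuous f].

End BaireClasses.

Section TopologicalGroups.
Variable G : topologicalZmodType.

Definition precompact_group := forall U : set G, nbhs (0 : G) U ->
  exists2 F : set G,
    finite_set F & \bigcup_(g in F) [set g + x | x in U] = [set: G].

Definition group_entourage : set_system (G * G) :=
  filter_from (nbhs (0 : G)) (fun U => [set p | U (p.1 - p.2)]).

Definition complete_group := forall F : set_system G, ProperFilter F ->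
  (F, F) --> group_entourage -> exists l : G, F --> l.

End TopologicalGroups.

(* Main.v *)
Require Import Defs.
From HB Require Import structures.
From mathcomp Require Import all_boot all_order all_algebra.
From mathcomp Require Import all_classical all_reals all_analysis.
From mathcomp Require Import wochoice lra.

Set Implicit Arguments.
Unset Strict Implicit.
Unset Printing Implicit Defensive.

Import Order.TTheory GRing.Theory Num.Theory.
Import numFieldNormedType.Exports.

Local Open Scope classical_set_scope.
Local Open Scope ring_scope.

(** A metrizable group that is not precompact contains a sequence [g] that is
    closed and discrete: points are chosen one after the other outside the
    translates, by a fixed neighbourhood of zero, of the points chosen before
    ([not_precompact_separated]). On the side of [X], first countability and the
    supply of continuous functions make every function that vanishes off one
    point a limit of continuous bumps, so that the first Baire class, and with it
    [H], is closed under changing a function at finitely many points; the second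
    Baire class contains all functions that are constant off a countable set.
    These two facts and the constant functions carry the proof.

    Closure under finite changes makes [H] look locally like the full power: a
    basic neighbourhood restricts finitely many coordinates, and the remaining
    ones may be chosen at will. Resetting all but finitely many coordinates
    gives the sequences that [kappa]-Fréchet-Urysohn asks for
    ([finite_change_kfu]), and a sequence together with its limit is a compact
    set on which a failure of equicontinuity becomes visible ([kfu_ascoli]).

    If [X] is countable, interpolation shows that every function is of the first
    Baire class, so [H] is the full power and is metrizable by a supremum of
    truncated distances. Metrizable spaces have the properties from countable
    tightness to normality; only the network of [metric_sigma] takes some work.

    If [X] is uncountable, each property fails by a diagonal argument against
    countably many coordinates. For countable tightness and for points of type
    G-delta, which sigma-spaces have, a single coordinate is moved. For
    cs*-networks a sequence of disjointly supported functions escapes. For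
    k-spaces one uses that compact sets are bounded, in terms of the indices of
    [g], at each coordinate, and that infinitely many coordinates share a
    bound. For normality Stone's argument for uncountable powers of the natural
    numbers goes through, since the functions that it uses are constant off
    countable sets; the same functions defeat the Lindelöf property by the
    pigeonhole principle.

    Čech-completeness is replaced by the existence of a complete sequence of open
    covers ([complete_cover_sequence]). For [H] such a sequence forces [X] to be
    countable, again by moving one coordinate along [g]; it passes to [G], and
    there a Baire category argument yields completeness
    ([complete_covers_group]). Conversely, a countable power of a complete
    metrizable group has a complete sequence of covers, and any metrizable
    space with one is a G-delta in its closure in a cube
    ([metric_covers_cech_complete]). *)

(** * Metrizable spaces *)

Lemma infinite_nat_geq (N : nat) : infinite_set [set k | (N <= k)%N].
Proof.
move=> fN; apply: infinite_nat.
apply: (@sub_finite_set _ _ (`I_N `|` [set k | (N <= k)%N])); last first.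
  by rewrite finite_setU; split=> //; exact: finite_II.
by move=> k _ /=; case: (ltnP k N) => ?; [left|right].
Qed.

(** A filter on the set either clusters at the limit or contains a finite set of
    terms. *)
Lemma compact_cvg_sequence (T : topologicalType) (u : nat -> T) (x : T) :
  u @ \oo --> x -> compact (x |` range u).
Proof.
move=> ux F PF FK; have [cx|] := pselect (cluster F x).
  by exists x; split=> //; left.
move=> /existsNP[A /existsNP[U /not_implyP[FA /not_implyP[Ux AU0]]]].
have [N _ NU] := ux U Ux.
have cI : compact (u @` `I_N).
  by apply: finite_compact; apply: finite_image; exact: finite_II.
have FI : F (u @` `I_N).
  apply: filterS (filterI FK FA) => y [[->|[n _ <-]] Ay].
    by exfalso; apply: AU0; exists x; split=> //; exact: nbhs_singleton.
  exists n => //=; rewrite ltnNge; apply/negP => Nn.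
  by apply: AU0; exists (u n); split=> //; exact: (NU n Nn).
by have [y [[n nN <-] cy]] := cI F PF FI; exists (u n); split=> //; right; exists n.
Qed.

Section Metric.
Variables (R : realType) (Z : topologicalType).

Definition metrizes (d : Z -> Z -> R) :=
  [/\ forall x y, d x y = 0 <-> x = y,
      forall x y, d x y = d y x,
      forall x y z, d x z <= d x y + d y z &
      forall x U, nbhs x U <-> exists2 e : R, 0 < e & forall z, d x z < e -> U z].

Lemma metrizableP : metrizable Z R <-> exists d, metrizes d.
Proof.
split=> -[d [d0 dC dT dn]]; exists d; split=> // x.
- move=> U; rewrite dn; split=> -[e e0 eU]; exists e => //.
- rewrite predeqE => U; rewrite dn; split=> -[e e0 eU]; exists e => //.
Qed.

Lemma eventually_natSinv_lt (e : R) : 0 < e -> exists n, n.+1%:R^-1 < e.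
Proof.
move=> e0; have [N _ /(_ N (leqnn N)) HN] := near_infty_natSinv_lt (PosNum e0).
by exists N.
Qed.

Lemma natSinv_le (m n : nat) : (m <= n)%N -> n.+1%:R^-1 <= m.+1%:R^-1 :> R.
Proof. by move=> mn; rewrite lef_pV2 ?posrE ?ltr0n// ler_nat ltnS. Qed.

Variable d : Z -> Z -> R.
Hypothesis dM : metrizes d.

Let dxx x : d x x = 0. Proof. by case: dM => d0 _ _ _; apply/d0. Qed.
Let dC x y : d x y = d y x. Proof. by case: dM. Qed.
Let dT y x z : d x z <= d x y + d y z. Proof. by case: dM. Qed.
Let dn x U : nbhs x U <-> exists2 e : R, 0 < e & forall z, d x z < e -> U z.
Proof. by case: dM. Qed.

Lemma metric_ge0 x y : 0 <= d x y.
Proof.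
have := dT y x x; rewrite dxx (dC y x) -mulr2n -[_ *+ 2]mulr_natl.
by rewrite pmulr_rge0 // ltr0n.
Qed.

Lemma metric_gt0 x y : x <> y -> 0 < d x y.
Proof.
move=> xy; rewrite lt0r metric_ge0 andbT; apply/eqP => dxy0; apply: xy.
by case: dM => d0 _ _ _; apply/d0.
Qed.

Lemma metric_ball_nbhs x (e : R) : 0 < e -> nbhs x [set z | d x z < e].
Proof. by move=> e0; apply/dn; exists e. Qed.

Lemma metric_ball_open x (e : R) : open [set z | d x z < e].
Proof.
rewrite openE => y /= xy; apply/dn; exists (e - d x y); first by rewrite subr_gt0.
move=> z yz /=; apply: (le_lt_trans (dT y x z)).
by rewrite addrC -ltrBrDr.
Qed.

Lemma metric_nbhsP x U :
  nbhs x U <-> exists n, forall z, d x z < n.+1%:R^-1 -> U z.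
Proof.
split=> [/dn[e e0 eU]|[n nU]]; last by apply/dn; exists n.+1%:R^-1.
have [n ne] := eventually_natSinv_lt e0.
by exists n => z xz; apply: eU; apply: lt_trans ne.
Qed.

Lemma metric_hausdorff : hausdorff_space Z.
Proof.
move=> x y xy; apply: contrapT => nxy.
have dxy := metric_gt0 nxy; have d2 : 0 < d x y / 2 by rewrite divr_gt0.
have [z [/= xz yz]] := xy _ _ (metric_ball_nbhs x d2) (metric_ball_nbhs y d2).
have := le_lt_trans (dT z x y) (ltrD xz (_ : d z y < d x y / 2)).
by rewrite -splitr ltxx dC => /(_ yz).
Qed.

Lemma metric_cvg (u : nat -> Z) x :
  (forall n, d x (u n) < n.+1%:R^-1) -> u @ \oo --> x.
Proof.
move=> ux U /metric_nbhsP[n nU]; exists n => // m /= nm; apply: nU.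
by apply: lt_le_trans (ux m) (natSinv_le nm).
Qed.

Lemma metric_closure_sequence (A : set Z) x : closure A x ->
  exists u : nat -> Z, (forall n, A (u n)) /\ u @ \oo --> x.
Proof.
move=> Ax; have /choice[u uP] n : exists y, A y /\ d x y < n.+1%:R^-1.
  have [|y [Ay xy]] := Ax [set z | d x z < n.+1%:R^-1]; last by exists y.
  exact: metric_ball_nbhs.
exists u; split=> [n|]; first by have [] := uP n.
by apply: metric_cvg => n; have [] := uP n.
Qed.

Lemma metric_countable_tightness : countable_tightness Z.
Proof.
move=> A x /metric_closure_sequence[u [uA ux]]; exists (range u); split.
- exact: card_image_le.
- by move=> _ [n _ <-].
- move=> U /ux[N _ NU]; exists (u N); split; first by exists N.
  exact: (NU N (leqnn N)).
Qed.

Lemma metric_cs_star : countable_cs_star_character Z.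
Proof.
move=> x; exists (range (fun n : nat => [set z | d x z < n.+1%:R^-1])).
  exact: card_image_le.
move=> u O ux /metric_nbhsP[n nO]; exists [set z | d x z < n.+1%:R^-1].
split=> //; first by rewrite /= dxx.
have n0 : 0 < n.+1%:R^-1 :> R by [].
have [N _ NU] := ux _ (metric_ball_nbhs x n0).
have := @infinite_nat_geq N.
by apply: sub_infinite_set => k Nk; exact: (NU k Nk).
Qed.

(** Well-order the points. For every radius, assign [z] to the first centre [x]
    whose ball contains it, and keep only those [z] whose ball of a second radius
    stays in that ball. For fixed radii, points assigned to different centres
    are at least the second radius apart, so the resulting family is discrete;
    varying the second radius exhausts all points. *)
Lemma metric_sigma : sigma_space Z.
Proof.
have [rel wo] := well_ordering_principle Z.
have rel_anti x y : rel x y -> rel y x -> x = y.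
  move=> xy yx; have [|z [_ zu]] := wo (pred2 x y).
    by exists x; rewrite inE /= eqxx.
  have rel_refl u : rel u u.
    have [|v [[uv vl] _]] := wo (pred1 u); first by exists u; rewrite inE.
    by move: uv vl; rewrite !inE => /eqP -> /(_ u); apply; rewrite !inE.
  rewrite -(zu x) ?(zu y)//; split; rewrite ?inE/= ?eqxx ?orbT//.
    by move=> u; rewrite !inE => /orP[] /eqP ->.
  by move=> u; rewrite !inE => /orP[] /eqP ->.
pose B n x := [set z | d x z < n.+1%:R^-1].
pose S n m x := [set z | [/\ B n x z, forall y, B n y z -> rel x y &
                             B m z `<=` B n x]].
pose F k := if unpickle k is Some (n, m) then range (S n m) else set0.
exists F.
  move=> k z; rewrite /F; case: unpickle => [[n m]|]; last first.
    by exists setT; [exact: filterT|apply: sub_finite_set (finite_set0 _) => A []].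
  have m2 : 0 < m.+1%:R^-1 / 2 :> R by rewrite divr_gt0.
  exists [set y | d z y < m.+1%:R^-1 / 2]; first exact: metric_ball_nbhs.
  have [[C [[x _ <-] Cz]]|h] :=
    pselect (exists C, range (S n m) C /\ C `&` [set y | d z y < m.+1%:R^-1 / 2] !=set0);
    last by apply: sub_finite_set (finite_set0 _) => A hA; apply: h; exists A.
  apply: sub_finite_set (finite_set1 (S n m x)) => _ [[y _ <-]].
  move=> [q [[qy yq By] /= zq]]; case: Cz => p [[px xp Bx] /= zp].
  have pq : d p q < m.+1%:R^-1.
    by rewrite (le_lt_trans (dT z p q))// [ltRHS]splitr ltrD// dC.
  have -> // : y = x.
  by apply: rel_anti; [exact/yq/Bx|apply/xp/By; rewrite /B/= dC].
move=> x O /(metric_nbhsP)[n nO]; have n2 : 0 < n.+1%:R^-1 / 2 :> R by rewrite divr_gt0.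
have [k kn] := eventually_natSinv_lt n2.
have [|y [[yx ymin] _]] := wo [pred y | d y x < k.+1%:R^-1].
  by exists x; rewrite !inE/= dxx.
rewrite !inE/= in yx.
have [m mB] : exists m, B m x `<=` B k y.
  have /metric_nbhsP[m mB] : nbhs x (B k y).
    by apply: open_nbhs_nbhs; split => //; exact: metric_ball_open.
  by exists m.
exists (S k m y); split.
- exists (pickle (k, m)) => //; rewrite /F pickleK; by exists y.
- by split=> // z zx; apply: ymin; rewrite inE.
- move=> z [yz _ _]; apply: nO; rewrite (le_lt_trans (dT y x z))//.
  by rewrite [ltRHS]splitr ltrD// ?(dC x y); apply: lt_trans kn.
Qed.

(** A sequence in [A] converging outside [A], together with its limit, is the
    compact set on which [A] is seen not to be closed. *)
Lemma metric_k_space : k_space Z.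
Proof.
move=> A /existsNP[x /not_implyP[/metric_closure_sequence[u [uA ux]] nAx]].
exists (x |` range u); first exact: compact_cvg_sequence.
move=> /(_ x) cl; suff : ((x |` range u) `&` A) x by case.
apply: cl => U; rewrite /nbhs/= -nbhs_subspace_in; last by left.
move=> /ux[N _ NU]; exists (u N).
have Ku : (x |` range u) (u N) by right; exists N.
by split; [split|exact: (NU N (leqnn N))].
Qed.

Lemma metric_normal : normal_space Z.
Proof.
move=> A cA B AB.
have /choice[e eP] x : exists e : R, 0 < e /\ (A x -> forall z, d x z < e -> B z).
  have [Ax|] := pselect (A x); last by exists 1.
  by have /dn[e e0 eB] := AB x Ax; exists e.
have e2 x : 0 < e x / 2 by rewrite divr_gt0//; case: (eP x).
exists [set z | exists2 x, A x & d x z < e x / 2].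
  move=> x Ax; apply: filterS (metric_ball_nbhs x (e2 x)) => z /= xz.
  by exists x.
move=> p cp; apply: contrapT => nBp.
have nAp : ~ A p by move=> Ap; apply: nBp; exact: nbhs_singleton (AB p Ap).
have : nbhs p (~` A) by apply: open_nbhs_nbhs; split=> //; exact: closed_openC.
move=> /dn[r r0 rA]; have r2 : 0 < r / 2 by rewrite divr_gt0.
have [z [[x Ax xz] /= pz]] := cp _ (metric_ball_nbhs p r2).
have xpe : e x <= d x p.
  by rewrite leNgt; apply/negP => xp; apply: nBp; have [_ /(_ Ax)] := eP x; apply.
have xpr : r <= d x p.
  by rewrite leNgt dC; apply/negP => /rA.
have := dT z x p; rewrite (dC z p); lra.
Qed.

(** The balls with centre in a countable dense set and radius [1/(n+1)] that fit
    into a member of the cover are countably many and still cover. *)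
Lemma metric_separable_lindelof : separable_space Z -> lindelof_space Z.
Proof.
move=> [D cD dD] C oC CT.
pose P (qn : Z * nat) := exists2 U, C U & [set z | d qn.1 z < qn.2.+1%:R^-1] `<=` U.
have /choice[f fP] qn : exists V, P qn ->
    C V /\ [set z | d qn.1 z < qn.2.+1%:R^-1] `<=` V.
  have [[U CU qU]|nP] := pselect (P qn); first by exists U.
  by exists set0.
exists (f @` ((D `*` [set: nat]) `&` P)); split.
- apply: card_le_trans (card_image_le _ _) _.
  apply: card_le_trans (subset_card_le (@subIsetl _ _ _)) _.
  by apply: countableX => //; exact: countableP.
- by move=> _ [qn [_ /fP[]] + _ <-].
rewrite predeqE => z; split=> // _.
have : [set: Z] z by []. rewrite -CT => -[U CU Uz].
have /(metric_nbhsP)[n nU] : nbhs z U by apply: open_nbhs_nbhs; split => //; exact: oC.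
have n2 : 0 < n.+1%:R^-1 / 2 :> R by rewrite divr_gt0.
have [k kn] := eventually_natSinv_lt n2.
have [||q [/= zq Dq]] := dD [set y | d z y < k.+1%:R^-1].
- by exists z; rewrite /= dxx.
- exact: metric_ball_open z _.
have Pq : P (q, k).
  exists U => // y /= qy; apply: nU; rewrite (le_lt_trans (dT q z y))//.
  by rewrite [ltRHS]splitr ltrD//; apply: lt_trans kn.
exists (f (q, k)); first by exists (q, k).
by have [_] := fP _ Pq; apply; rewrite /= dC.
Qed.

Lemma metric_lindelof_separable : lindelof_space Z -> separable_space Z.
Proof.
move=> lZ.
have /choice[E EP] n : exists E : set Z, countable E /\
    forall z, exists2 x, E x & d x z < n.+1%:R^-1.
  pose ball x := [set z | d x z < n.+1%:R^-1].
  have [||C [cC CB CT]] := lZ (range ball).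
  - by move=> _ [x _ <-]; exact: metric_ball_open.
  - rewrite predeqE => z; split=> // _; exists (ball z); first by exists z.
    by rewrite /ball /= dxx.
  (* [Z] may be empty, whence the option type *)
  have /choice[c cP] U : exists x : option Z, C U -> exists2 y, x = Some y & U = ball y.
    have [CU|] := pselect (C U); last by exists None.
    by have [x _ <-] := CB _ CU; exists (Some x) => _; exists x.
  exists [set x | exists2 U, C U & c U = Some x]; split.
    have : countable (c @` C) by apply: card_le_trans (card_image_le _ _) _.
    apply: card_le_trans; rewrite -card_ge_some.
    apply: subset_card_le => _ [x [U CU cU] <-]; by exists U.
  move=> z; have : [set: Z] z by []. rewrite -CT => -[U CU Uz].
  have [y cU UE] := cP U CU; exists y; first by exists U.
  by move: Uz; rewrite UE.
exists (\bigcup_n E n).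
  by apply: bigcup_countable => // n _; have [] := EP n.
move=> U [z Uz] oU.
have /(metric_nbhsP)[n nU] : nbhs z U by apply: open_nbhs_nbhs.
have [_ /(_ z)[x Ex xz]] := EP n.
by exists x; split; [apply: nU; rewrite dC|exists n].
Qed.

End Metric.

(** * The topology of pointwise convergence *)

Lemma initial_cvgP (S : choiceType) (T : topologicalType) (f : S -> T)
    (F : set_system S) (s : S) : Filter F ->
  F --> (s : initial_topology f) <-> f @ F --> f s.
Proof.
move=> FF; split=> [Fs|fFs].
  apply: cvg_comp Fs _; exact: (@initial_continuous S T f).
move=> U [_ [[C oC <-] Cs] CU].
have /fFs : nbhs (f s) C by apply: open_nbhs_nbhs.
by move=> FC; apply: filterS CU _; exact: FC.
Qed.

Section Pointwise.
Variables (X : choiceType) (Y : topologicalType) (H : set {ptws X -> Y}).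
Let HT : topologicalType := set_type H.

Lemma ptws_cvgP (F : set_system HT) (f : HT) : Filter F ->
  F --> f <-> forall x, (fun h : HT => val h x) @ F --> val f x.
Proof.
move=> FF; apply: iff_trans (@initial_cvgP _ _ (set_val : HT -> _) F f FF) _.
rewrite cvg_sup; split=> h x.
  by have /(@initial_cvgP _ _ (fun g : {ptws X -> Y} => g x)) := h x.
by apply/(@initial_cvgP _ _ (fun g : {ptws X -> Y} => g x)); exact: h.
Qed.

Lemma ptws_cvg_seqP (u : nat -> HT) (f : HT) :
  u @ \oo --> f <-> forall x, val (u n) x @[n --> \oo] --> val f x.
Proof. exact: ptws_cvgP. Qed.

Lemma eval_continuous x : continuous (fun h : HT => val h x).
Proof. by move=> f; exact: (proj1 (@ptws_cvgP _ f (nbhs_filter f)) (@cvg_id _ _) x). Qed.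

Lemma ptws_nbhsP (f : HT) (U : set HT) : nbhs f U <->
  exists (A : seq X) (W : X -> set Y), (forall x, nbhs (val f x) (W x)) /\
    forall h : HT, (forall x, x \in A -> W x (val h x)) -> U h.
Proof.
split=> [|[A [W [fW WU]]]]; last first.
  suff : nbhs f [set h : HT | forall x, x \in A -> W x (val h x)].
    by apply: filterS => h; exact: WU.
  elim: A {WU} => [|a A IH]; first exact: filterE.
  have nWa : nbhs f [set h : HT | W a (val h a)] := eval_continuous (fW a).
  apply: filterS (filterI nWa IH) => h /= [Wa WA] x.
  by rewrite inE => /orP[/eqP ->//|/WA].
pose D := [set p : seq X * (X -> set Y) | forall x, nbhs (val f x) (p.2 x)].
pose B (p : seq X * (X -> set Y)) :=
  [set h : HT | forall x, x \in p.1 -> p.2 x (val h x)].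
have FB : Filter (filter_from D B).
  apply: filter_from_filter; first by exists ([::], fun=> setT) => x /=; exact: filterT.
  move=> [A1 W1] [A2 W2] /= D1 D2; exists (A1 ++ A2, fun x => W1 x `&` W2 x).
    by move=> x /=; exact: filterI (D1 x) (D2 x).
  by move=> h Bh; split=> x xA; have [] := Bh x; rewrite //= mem_cat xA ?orbT.
have /(_ U) : filter_from D B --> f.
  apply/ptws_cvgP => x V fV; exists ([:: x], fun y => if y == x then V else setT).
    by move=> y /=; case: eqP => [->//|_]; exact: filterT.
  by move=> h /(_ x); rewrite /= mem_seq1 eqxx; apply.
by move=> BU /BU [[A W] DW WU]; exists A, W; split=> // h; exact: WU.
Qed.

Lemma ptws_hausdorff : hausdorff_space Y -> hausdorff_space HT.
Proof.
move=> hY f g fg; apply/val_inj/funext => x; apply: hY => A B fA gB.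
by have [h [/=]] := fg _ _ (eval_continuous fA) (eval_continuous gB); exists (val h x).
Qed.

End Pointwise.

(** Neighbourhoods in the pointwise topology speak of finite lists of
    coordinates; this supplies lists that exhaust a countable set. *)
Lemma injective_initial_segment (T : choiceType) (D : set T) (idx : T -> nat) n :
  {in D &, injective idx} ->
  exists A : seq T, forall x, x \in A <-> D x /\ (idx x < n)%N.
Proof.
move=> idx_inj; elim: n => [|n [A AP]].
  by exists [::] => x; split=> // -[].
have [[a [Da an]]|h] := pselect (exists a, D a /\ idx a = n); last first.
  exists A => x; rewrite AP; split=> -[Dx xn]; split=> //.
    exact: ltnW.
  move: xn; rewrite ltnS leq_eqVlt => /orP[/eqP xn|//].
  by case: h; exists x.
exists (a :: A) => x; rewrite inE; split.
  move=> /orP[/eqP ->|/AP[Dx xn]]; first by rewrite an.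
  by split=> //; exact: ltnW.
move=> [Dx]; rewrite ltnS leq_eqVlt => /orP[/eqP xn|xn].
  have -> : x = a; last by rewrite eqxx.
  by apply: idx_inj; [exact: mem_set|exact: mem_set|rewrite an].
by apply/orP; right; apply/AP.
Qed.

(** Truncation preserves the triangle inequality. *)
Lemma min_subadd (R : realDomainType) (p q r c : R) :
  0 <= q -> 0 <= r -> 0 <= c -> p <= q + r ->
  Num.min p c <= Num.min q c + Num.min r c.
Proof.
move=> q0 r0 c0 pqr; rewrite ge_min.
have [_|_] := leP q c; have [_|_] := leP r c.
- by rewrite pqr.
- by rewrite lerDr q0 orbT.
- by rewrite lerDl r0 orbT.
- by rewrite lerDl c0 orbT.
Qed.

(** Over a countable index set the pointwise topology comes from the supremum
    of truncated coordinate distances: truncating the distance of the i-th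
    coordinate at 1/(i+1) leaves only finitely many coordinates relevant at
    every scale. *)
Section PointwiseMetric.
Variables (R : realType) (X : choiceType) (Y : topologicalType).
Variables (H : set {ptws X -> Y}) (d : Y -> Y -> R) (idx : X -> nat).
Hypothesis dM : metrizes d.
Hypothesis idx_inj : injective idx.
Hypothesis X0 : [set: X] !=set0.
Let HT : topologicalType := set_type H.

Let trunc (f g : HT) x := Num.min (d (val f x) (val g x)) (idx x).+1%:R^-1.

Definition ptws_dist (f g : HT) : R := sup (range (trunc f g)).

Let trunc_sup f g : has_sup (range (trunc f g)).
Proof.
split; first by have [x _] := X0; exists (trunc f g x), x.
exists 1 => _ [x _ <-]; rewrite ge_min; apply/orP; right.
by rewrite invf_le1 ?ler1n ?ltr0n.
Qed.

Let trunc_le f g x : trunc f g x <= ptws_dist f g.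
Proof. by apply: ub_le_sup; [have [] := trunc_sup f g|exists x]. Qed.

Let dist_le f g c : (forall x, trunc f g x <= c) -> ptws_dist f g <= c.
Proof.
move=> h; apply: ge_sup; first by have [] := trunc_sup f g.
by move=> _ [x _ <-].
Qed.

Lemma ptws_dist_metrizes : metrizes ptws_dist.
Proof.
have dxx y : d y y = 0 by case: dM => d0 _ _ _; apply/d0.
have dC x y : d x y = d y x by case: dM.
have i0 x : 0 < (idx x).+1%:R^-1 :> R by [].
split.
- move=> f g; split=> [fg0|->].
    apply/val_inj/funext => x; apply: contrapT => /(metric_gt0 dM) fgx.
    have := trunc_le f g x; rewrite fg0 leNgt => /negP; apply.
    by rewrite lt_min fgx i0.
  apply/eqP; rewrite eq_le; apply/andP; split.
    by apply: dist_le => x; rewrite /trunc dxx ge_min lexx.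
  have [x _] := X0; apply: le_trans (trunc_le g g x).
  by rewrite /trunc dxx le_min lexx ltW.
- move=> f g; rewrite /ptws_dist; have -> // : trunc f g = trunc g f.
  by apply/funext => x; rewrite /trunc dC.
- move=> f g h; apply: dist_le => x.
  apply: le_trans (lerD (trunc_le f g x) (trunc_le g h x)).
  apply: min_subadd; [exact: metric_ge0|exact: metric_ge0|exact: ltW|].
  by case: dM.
- move=> f U; rewrite ptws_nbhsP; split=> [[A [W [fW WU]]]|[e e0 eU]].
    have [e e0 eA] : exists2 e : R, 0 < e & forall x, x \in A ->
        e <= (idx x).+1%:R^-1 /\ forall z, d (val f x) z < e -> W x z.
      elim: A {WU} => [|a A [e e0 eA]]; first by exists 1.
      have /= [e' e'0 e'W] : exists2 e : R, 0 < e & forall z, d (val f a) z < e -> W a z.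
        by case: dM => _ _ _ h; apply/h.
      exists (Num.min e (Num.min e' (idx a).+1%:R^-1)).
        by rewrite !lt_min e0 e'0 i0.
      move=> x; rewrite inE => /orP[/eqP ->|xA].
        split; first by rewrite !ge_min lexx !orbT.
        by move=> z; rewrite !lt_min => /and3P[_ ? _]; exact: e'W.
      have [ei eW] := eA x xA; split; first by rewrite ge_min ei.
      by move=> z; rewrite !lt_min => /andP[? _]; exact: eW.
    exists e => // h fh; apply: WU => x xA; have [ei] := eA x xA; apply.
    have := le_lt_trans (trunc_le f h x) fh.
    by rewrite /trunc gt_min => /orP[//|]; rewrite ltNge ei.
  have [n ne] := eventually_natSinv_lt e0.
  have [A AP] := @injective_initial_segment _ setT idx n (in2W idx_inj).
  exists A, (fun x => [set z | d (val f x) z < n.+1%:R^-1]); split.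
    by move=> x; exact: metric_ball_nbhs.
  move=> h fh; apply: eU; apply: le_lt_trans ne; apply: dist_le => x.
  rewrite /trunc ge_min; case: (ltnP (idx x) n) => [xn|nx].
    by rewrite ltW//; apply: fh; apply/AP.
  by rewrite natSinv_le ?orbT.
Qed.

End PointwiseMetric.

(** * Čech-completeness through complete sequences of covers *)

(** Frolík's complete sequences of covers, the form of Čech-completeness that does
    not mention a compactification. *)
Definition complete_cover_sequence (Z : topologicalType) (C : nat -> set (set Z)) :=
  [/\ forall n, C n `<=` open,
      forall n z, exists2 U, C n U & U z &
      forall F : set_system Z, ProperFilter F ->
        (forall n, exists2 U, C n U & F U) -> cluster F !=set0].

(** If the range is the intersection of the open sets [W n], the n-th cover
    consists of the open sets whose image has its closure inside [W n]: a cluster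
    point in the compactification is then caught in every [W n]. *)
Lemma cech_complete_covers (Z : topologicalType) :
  cech_complete Z -> exists C, @complete_cover_sequence Z C.
Proof.
move=> [K [e [cK hK [einj eE] _ [W oW eW]]]].
have econt : continuous e.
  by apply/continuousP => V oV; rewrite eE; exists V.
exists (fun n => [set U | open U /\ closure (e @` U) `<=` W n]); split.
- by move=> n U [].
- move=> n z; have : nbhs (e z) (W n).
    apply: open_nbhs_nbhs; split; first exact: oW.
    have ez : range e (e z) by exists z.
    by rewrite eW in ez; exact: ez.
  move=> /(compact_regular hK cK (filterT))[V eV VW].
  exists (e @^-1` V^°); last exact: eV.
  split; first by apply: open_comp => //; exact: open_interior.
  apply: subset_trans VW; apply: closureS => _ [y Vy <-].
  exact: interior_subset.
- move=> F PF CF.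
  have [k [_ kF]] : [set: K] `&` cluster (e @ F) !=set0.
    by apply: cK; exact: filterT.
  have : range e k.
    rewrite eW => n _; have [U [_ UW] FU] := CF n; apply: UW => V kV.
    by apply: kF => //=; apply: filterS FU => z Uz; exists z.
  move=> [z _ zk]; exists z => A B FA; rewrite nbhsE => -[B' [oB' B'z] B'B].
  have [V oV VB'] : [set e @^-1` V | V in open] B' by rewrite -eE.
  have kV : nbhs k V.
    by apply: open_nbhs_nbhs; split=> //; rewrite -zk; move: B'z; rewrite -VB'.
  have [_ [[y Ay <-] Vy]] : (e @` A) `&` V !=set0.
    by apply: kF => //=; apply: filterS FA => y Ay; exists y.
  by exists y; split=> //; apply: B'B; rewrite -VB'.
Qed.

Lemma min1_lt (R : realDomainType) (a b r : R) :
  0 < r -> a < b + r -> Num.min a 1 < Num.min b 1 + r.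
Proof.
move=> r0 abr; rewrite gt_min; have [_|_] := leP b 1; first by rewrite abr.
by rewrite ltrDl r0 orbT.
Qed.

(** The metric compactification: truncated distances to all points embed [Z]
    into a cube, and the closure of the image is the compactification. *)
Section MetricCompactification.
Variables (R : realType) (Z : topologicalType) (d : Z -> Z -> R).
Hypothesis dM : metrizes d.

Let dxx x : d x x = 0. Proof. by case: dM => d0 _ _ _; apply/d0. Qed.
Let dC x y : d x y = d y x. Proof. by case: dM. Qed.
Let dT y x z : d x z <= d x y + d y z. Proof. by case: dM. Qed.

Let cube : set {ptws Z -> R} := [set f | forall y, `[0, 1]%classic (f y)].
Let e0 (z : Z) : {ptws Z -> R} := fun y => Num.min (d z y) 1.
Let img : set {ptws Z -> R} := closure (range e0).
Let K : topologicalType := set_type img.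

Let cube_compact : compact cube.
Proof.
exact: (@tychonoff Z (fun=> R) (fun=> `[0, 1]%classic)
  (fun=> @segment_compact R 0 1)).
Qed.

Let R_hausdorff : hausdorff_space R.
Proof. exact: norm_hausdorff. Qed.

Let cube_closed : closed cube.
Proof.
apply: compact_closed cube_compact.
by apply: (@hausdorff_product Z (fun=> R)) => _.
Qed.

Let img_cube : img `<=` cube.
Proof.
move/closure_id : cube_closed => ->; apply: closureS => _ [z _ <-] y.
rewrite /= in_itv /= /e0 le_min (metric_ge0 dM) ler01 /=.
by rewrite ge_min lexx orbT.
Qed.

Let e (z : Z) : K :=
  exist _ (e0 z) (mem_set (subset_closure (ex_intro2 _ _ z I erefl))).

Let K_compact : compact [set: K].
Proof.
move=> F PF _.
have [f [Cf cf]] : cube `&` cluster ((set_val : K -> _) @ F) !=set0.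
  apply: cube_compact => /=; apply: filterE => k; apply: img_cube.
  exact: set_valP.
have If : img f.
  apply: closed_closure => A fA.
  have [_ [[k _ <-] Ak]] : range (set_val : K -> _) `&` A !=set0.
    by apply: cf => //; apply: (@filterE _ F) => k; exists k.
  by exists (set_val k); split=> //; exact: set_valP.
exists (exist _ f (mem_set If)); split=> // A B FA [_ [[V oV <-] Vf] VB].
have [_ [[k Ak <-] Vk]] : (set_val @` A) `&` V !=set0.
  apply: cf; first by apply: (@filterS _ F _ A) => // k Ak; exists k.
  by apply: open_nbhs_nbhs.
by exists k; split=> //; exact: VB.
Qed.

Let K_hausdorff : hausdorff_space K.
Proof. exact: ptws_hausdorff. Qed.

Let e_dense : dense (range e).
Proof.
move=> O [k Ok] [V oV VO].
have Vk : V (set_val k) by move: Ok; rewrite -VO.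
have /(_ V)[|_ [[z _ <-] Vz]] : closure (range e0) (set_val k) := set_valP k.
  by apply: open_nbhs_nbhs.
by exists (e z); split; [rewrite -VO|exists z].
Qed.

Let e_ball z (r : R) : 0 < r ->
  nbhs (e z) [set k : K | val k z < Num.min r 1].
Proof.
move=> r0; have ev := @eval_continuous Z R img z (e z).
apply: (ev [set x | x < Num.min r 1]).
have : nbhs (0 : R) [set x | x < Num.min r 1].
  by apply: open_nbhs_nbhs; split; [exact: open_lt|rewrite /= lt_min r0 ltr01].
by rewrite /= /e0 dxx /Num.min ltr01.
Qed.

Let e_embedding : topological_embedding e.
Proof.
have e_nbhs z U : nbhs z U -> exists2 V : set K, open_nbhs (e z) V & e @^-1` V `<=` U.
  case: dM => _ _ _ h /h[r r0 rU].
  have := e_ball z r0; rewrite nbhsE => -[V zV VU]; exists V => // y /VU /=.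
  rewrite /e0 dC => yz; apply: rU; move: yz.
  rewrite lt_min !gt_min ltxx orbF => /andP[/orP[//|r1] d1].
  exact: lt_trans r1.
have e_cont : continuous e.
  move=> z; apply/ptws_cvgP => y /=; apply/cvgrPdist_lt => r r0.
  have := metric_ball_nbhs dM z r0; apply: filterS => x /= zx.
  rewrite ltr_distl; apply/andP; split.
    by rewrite ltrBlDr; apply: min1_lt => //; have := dT z x y; rewrite (dC x z); lra.
  by apply: min1_lt => //; have := dT x z y; lra.
split.
  move=> x y /(congr1 val)/(congr1 (fun f => f y)); rewrite /= /e0 dxx => xy.
  apply: contrapT => /(metric_gt0 dM) dxy.
  have : 0 < Num.min (d x y) 1 by rewrite lt_min dxy ltr01.
  by rewrite xy lt_min ltxx.
rewrite predeqE => U; split=> [oU|[V oV <-]]; last by move/continuousP: e_cont; apply.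
exists (\bigcup_(V in [set V | open V /\ e @^-1` V `<=` U]) V).
  by apply: bigcup_open => V [].
rewrite predeqE => z; split=> [[V [_ VU] Vz]|Uz]; first exact: VU.
have [|V [oV Vz] VU] := e_nbhs z U; first exact: open_nbhs_nbhs.
by exists V.
Qed.

(** A point [k] of the compactification that is near some member of each cover
    traces on [Z] a filter containing such members; a cluster point of this
    filter is mapped to [k]. *)
Lemma metric_covers_cech_complete C : @complete_cover_sequence Z C -> cech_complete Z.
Proof.
move=> [oC CT CF]; exists K, e; split;
  [exact: K_compact|exact: K_hausdorff|exact: e_embedding|exact: e_dense|].
pose W n := \bigcup_(V in [set V : set K | open V /\
  exists2 U, C n U & e @^-1` V `<=` U]) V.
exists W; first by move=> n; apply: bigcup_open => V [].
have [einj eE] := e_embedding.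
rewrite predeqE => k; split=> [[z _ <-] n _|kW].
  have [U CU Uz] := CT n z; have := oC n U CU; rewrite eE => -[V oV VU].
  exists V; last by move: Uz; rewrite -VU.
  by split=> //; exists U => //; rewrite VU.
pose F := filter_from (nbhs k) (fun V => e @^-1` V).
have PF : ProperFilter F.
  apply: filter_from_proper; last first.
    move=> V; rewrite nbhsE => -[V' [oV' V'k] V'V].
    have [|k' [V'z [z _ zE]]] := e_dense _ oV'; first by exists k.
    by exists z; apply: V'V; rewrite /= zE.
  apply: filter_from_filter; first by exists setT; exact: filterT.
  by move=> A B kA kB; exists (A `&` B) => //; exact: filterI.
have [n|z zF] := CF F PF.
  have [V [oV [U CU VU]] Vk] := kW n I; exists U => //; exists V => //.
  exact: open_nbhs_nbhs.
exists z => //; apply/esym/K_hausdorff => A B kA zB.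
have e_cont : continuous e by apply/continuousP => V oV; rewrite eE; exists V.
have [y [Ay By]] : (e @^-1` A) `&` (e @^-1` B) !=set0.
  by apply: zF; [exists A|exact: e_cont].
by exists (e y).
Qed.

End MetricCompactification.

(** * Fréchet–Urysohn for open sets implies Ascoli *)

Lemma cvg_shift (T : topologicalType) (u : nat -> T) (x : T) (N : nat) :
  u @ \oo --> x -> (fun n => u (n + N)%N) @ \oo --> x.
Proof.
move=> ux U /ux[M _ MU]; exists M => // n /= Mn; apply: MU => /=.
exact: leq_trans (leq_addr _ _).
Qed.

Lemma dist_open (R : realType) (a r : R) : open [set x : R | `|x - a| < r].
Proof.
have /continuousP/(_ _ (@open_lt R r)) // : continuous (fun x : R => `|x - a|).
by move=> x; apply: cvg_norm; apply: cvgB; [exact: cvg_id|exact: cvg_cst].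
Qed.

Section KappaFrechetUrysohnAscoli.
Variables (R : realType) (Z : topologicalType).
Let C := set_type (@Ck Z R).
Lemma Ck_nbhs (f : C) (S : set Z) (O : set R) : compact S -> open O ->
  (forall z, S z -> O (val f z)) ->
  nbhs f [set g : C | forall z, S z -> O (val g z)].
Proof.
move=> cS oO fO.
have oT := @compact_open_open Z R S O cS oO.
exists (set_val @^-1` [set g : {compact-open, Z -> R} | g @` S `<=` O]).
  split; first by exists [set g : {compact-open, Z -> R} | g @` S `<=` O].
  by move=> _ [z Sz <-]; exact: fO.
by move=> g gO z Sz; apply: gO; exists z.
Qed.

Hypothesis kfu : kappa_frechet_urysohn Z.

(** A failure of equicontinuity at [z] lives on an open set with [z] in its
    closure, hence along a sequence; a tail of that sequence and its
    limit form a compact set, on which the offending functions come close to the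
    nearly constant values of one of their cluster points. *)
Lemma kfu_compact_equicontinuous (K : set C) z (eps : R) : compact K -> 0 < eps ->
  nbhs z [set y | forall f : C, K f -> `|val f y - val f z| <= eps].
Proof.
move=> cK e0; apply: contrapT => nN.
pose U := \bigcup_(f in K) [set y | eps < `|val f y - val f z|].
have fcont (f : C) : continuous (val f : Z -> R) by exact: set_valP f.
have oU : open U.
  apply: bigcup_open => f Kf.
  have cf : continuous (fun y => `|val f y - val f z|).
    move=> y; apply: cvg_norm; apply: cvgB; last exact: cvg_cst.
    exact: fcont.
  by move/continuousP: cf => /(_ _ (@open_gt R eps)).
have zU : closure U z.
  move=> B zB; apply: contrapT => BU; apply: nN; apply: filterS zB => y By f Kf.
  rewrite leNgt; apply/negP => fy; apply: BU; exists y; split=> //.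
  by exists f.
have [u [uU uz]] := kfu oU zU.
have /choice[f fP] n : exists f, K f /\ eps < `|val f (u n) - val f z|.
  by have [f Kf fu] := uU n; exists f.
have [g [Kg cg]] : K `&` cluster (f @ \oo) !=set0.
  by apply: cK; exists 0%N => // n _; have [] := fP n.
have e3 : 0 < eps / 2 by rewrite divr_gt0.
have nO : nbhs z [set y | `|val g y - val g z| < eps / 2].
  have /cvgrPdist_lt/(_ _ e3) := fcont g z.
  by apply: filterS => y; rewrite /= distrC.
have [N _ NU] := uz _ nO.
(* the compact-open topology sees only values in an open set, so the sequence
   is cut to the part where [g] is already close to [g z] *)
pose S := z |` range (fun n => u (n + N)%N).
have cS : compact S by apply: compact_cvg_sequence; exact: cvg_shift.
have oB := @dist_open R (val g z) (eps / 2).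
have gS y : S y -> `|val g y - val g z| < eps / 2.
  move=> [->|[n _ <-]]; first by rewrite subrr normr0.
  by apply: NU => /=; exact: leq_addl.
have fN : (f @ \oo) (f @` [set n | (N <= n)%N]) by exists N => // n Nn; exists n.
have [_ [[n /= Nn <-] fn]] := cg _ _ fN (Ck_nbhs cS oB gS).
have [_] := fP n; apply/negP; rewrite -leNgt.
have Su : S (u n) by right; exists (n - N)%N => //; rewrite subnK.
have Sz : S z by left.
have h1 := fn _ Su; have h2 := fn _ Sz; rewrite /= in h1 h2.
rewrite ltW// (le_lt_trans (ler_distD (val g z) _ _))//.
by rewrite [ltRHS]splitr ltrD// distrC.
Qed.

(** Equicontinuity in the second variable and evaluation at [z] in the first give
    joint continuity. *)
Lemma kfu_ascoli : ascoli_space Z R.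
Proof.
move=> K cK; apply/subspace_continuousP => -[f z] [/= Kf _].
apply/cvgrPdist_lt => eps e0.
have e2 : 0 < eps / 2 by rewrite divr_gt0.
have oB := @dist_open R (val f z) (eps / 2).
have fN : nbhs f [set g : C | forall y, [set z] y -> `|val g y - val f z| < eps / 2].
  apply: Ck_nbhs oB _; first exact: compact_set1.
  by move=> _ ->; rewrite /= subrr normr0.
exists ([set g : C | forall y, [set z] y -> `|val g y - val f z| < eps / 2],
  [set y | forall f : C, K f -> `|val f y - val f z| <= eps / 2]).
  by split => //; exact: kfu_compact_equicontinuous.
move=> [g y] [/= gf gy] [Kg _] /=; rewrite distrC.
rewrite (le_lt_trans (ler_distD (val g z) _ _))//.
by rewrite [ltRHS]splitr ler_ltD//; [exact: gy|exact: gf].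
Qed.

End KappaFrechetUrysohnAscoli.

(** * Function spaces closed under finite changes *)

Lemma uncountable_ex (T : Type) (D : set T) :
  ~ countable [set: T] -> countable D -> exists x, ~ D x.
Proof.
move=> nT cD; apply: contrapT => /forallNP h; apply: nT.
by apply: sub_countable cD; apply: subset_card_le => x _; apply: contrapT; exact: h.
Qed.

Lemma countable_seqs (T : choiceType) (I : Type) (B : set I) (s : I -> seq T) :
  countable B -> countable (\bigcup_(b in B) [set x | x \in s b]).
Proof.
by move=> cB; apply: bigcup_countable => // b _; exact: finite_set_countable.
Qed.

Lemma infinite_uniq_seq (T : choiceType) (A : set T) n : infinite_set A ->
  exists s : seq T, [/\ uniq s, size s = n & forall x, x \in s -> A x].
Proof.
move=> /(@infinite_set_fset _ _ n)[B BA nB]; exists (take n (finmap.enum_fset B)).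
split; first by rewrite take_uniq// fset_uniq.
  by rewrite size_takel.
by move=> x /mem_take xB; apply: BA.
Qed.

Lemma hausdorff_neq_nbhs (Y : topologicalType) (y z : Y) : hausdorff_space Y -> y <> z ->
  nbhs y [set x | x <> z].
Proof.
move=> hY yz; apply: contrapT => nN; apply: yz; apply: hY => A B yA zB.
apply: contrapT => AB; apply: nN; apply: filterS yA => x Ax xz; apply: AB.
by exists x; split=> //; rewrite xz; exact: nbhs_singleton.
Qed.

(** The n-th neighbourhood of [z] avoids the members of the n-th locally finite
    family that are away from [z]; a small network element around a point
    [y <> z] is such a member. *)
Lemma sigma_points_Gdelta (Z : topologicalType) : hausdorff_space Z ->
  sigma_space Z -> forall z : Z, exists2 U : nat -> set Z,
    forall n, nbhs z (U n) & forall y, (forall n, U n y) -> y = z.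
Proof.
move=> hZ [F lF nF] z.
have /choice[U UP] n : exists U, nbhs z U /\
    forall A y, F n A -> A y -> U y -> closure A z.
  have [Q zO fO] := lF n z.
  pose E := [set A | (F n A /\ A `&` Q !=set0) /\ ~ closure A z].
  have fE : finite_set E by apply: sub_finite_set fO => A [].
  exists (Q `&` \bigcap_(A in E) ~` closure A); split.
    apply: filterI => //; rewrite -setC_bigcup; apply: open_nbhs_nbhs; split.
    apply: closed_openC; apply: closed_bigcup => // A _; exact: closed_closure.
    by move=> [A [_ nA] cA]; exact: nA.
  move=> A y FA Ay [Oy Ey]; apply: contrapT => nA.
  have EA : E A by split=> //; split=> //; exists y.
  exact: Ey EA (subset_closure Ay).
exists U; first by move=> n; have [] := UP n.
move=> y Uy; apply: contrapT => yz.
have [[P P']] : exists2 AB : set Z * set Z,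
    nbhs y AB.1 /\ nbhs z AB.2 & AB.1 `&` AB.2 = set0.
  apply: contrapT => nAB; apply: yz; apply: hZ => A B yA zB.
  apply/set0P/eqP => AB0; apply: nAB; by exists (A, B).
move=> /= [yP zP'] PP0; have [A [[n _ FA] Ay AP]] := nF y P yP.
have [x [Ax P'x]] := (UP n).2 A y FA Ay (Uy n) P' zP'.
have : (P `&` P') x by split => //; exact: AP.
by rewrite PP0.
Qed.

(** The sequence [g] runs through a closed discrete set without repetition. *)
Definition separated (Y : topologicalType) (g : nat -> Y) :=
  forall y : Y, exists2 Q : set Y,
    nbhs y Q & forall m n, Q (g m) -> Q (g n) -> m = n.

Section Separated.
Variables (Y : topologicalType) (g : nat -> Y).
Hypothesis hY : hausdorff_space Y.
Hypothesis sepg : separated g.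

Lemma separated_inj : injective g.
Proof.
move=> m n gmn; have [Q /nbhs_singleton Qg sQ] := sepg (g m).
by apply: sQ => //; rewrite -gmn.
Qed.

Lemma separated_closed (I : set nat) : closed (g @` I).
Proof.
move=> y cy; have [Q yO sO] := sepg y.
have [_ [[n In <-] On]] := cy Q yO.
apply: contrapT => ny; have yn : y <> g n by move=> yn; apply: ny; exists n.
have [_ [[m Im <-] [/= Om mn]]] := cy _ (filterI yO (hausdorff_neq_nbhs hY yn)).
by apply: mn; rewrite (sO m n).
Qed.

Lemma separated_no_cluster (phi : nat -> nat) y :
  (forall n, (n <= phi n)%N) -> ~ cluster ((g \o phi) @ \oo) y.
Proof.
move=> phin cy; have [Q yO sO] := sepg y.
have tail N : ((g \o phi) @ \oo) ((g \o phi) @` [set n | (N <= n)%N]).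
  by exists N => // n Nn; exists n.
have [_ [[m _ <-] /= Om]] := cy _ _ (tail 0%N) yO.
have [_ [[n /= mn <-] /= On]] := cy _ _ (tail (phi m).+1) yO.
by have := leq_trans mn (phin n); rewrite (sO _ _ Om On) ltnn.
Qed.

(** Infinitely many values in [K] would form a sequence with a cluster point. *)
Lemma separated_compact (K : set Y) : compact K ->
  exists M, forall n, K (g n) -> (n < M)%N.
Proof.
move=> cK; apply: contrapT => /forallNP h.
have /choice[phi phiP] M : exists n, K (g n) /\ (M <= n)%N.
  have /existsNP[n /not_implyP[Kn /negP]] := h M.
  by rewrite -leqNgt => Mn; exists n.
have [y [_]] : K `&` cluster ((g \o phi) @ \oo) !=set0.
  by apply: cK; exists 0%N => // n _; have [] := phiP n.
by apply: separated_no_cluster => n; have [] := phiP n.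
Qed.

End Separated.

Definition finite_change_closed (X : choiceType) (Y : Type) (H : set (X -> Y)) :=
  forall f h (A : seq X), H f -> (forall x, x \notin A -> h x = f x) -> H h.

Definition ptws_sub (X : choiceType) (Y : topologicalType)
  (H : set {ptws X -> Y}) (f : X -> Y) (Hf : H f) : set_type H :=
  exist _ f (mem_set Hf).

Section FiniteChange.
Variables (R : realType) (X : choiceType) (Y : topologicalType).
Variables (H : set {ptws X -> Y}) (d : Y -> Y -> R).
Hypothesis dM : metrizes d.
Hypothesis HF : finite_change_closed H.
Let HT : topologicalType := set_type H.

(** This is where countable families of neighbourhoods lose track of an
    uncountable set of coordinates. *)
Lemma nbhs_countable_coordinates (f : HT) (U : nat -> set HT) :
  (forall n, nbhs f (U n)) ->
  exists2 D : set X, countable D &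
    forall h : HT, (forall x, D x -> val h x = val f x) -> forall n, U n h.
Proof.
move=> fU; have /choice[A AP] n : exists A : seq X,
    forall h : HT, (forall x, x \in A -> val h x = val f x) -> U n h.
  have /ptws_nbhsP[A [W [fW WU]]] := fU n; exists A => h hf; apply: WU => x xA.
  by rewrite hf//; exact: nbhs_singleton.
exists (\bigcup_(n in [set: nat]) [set x | x \in A n]).
  exact: countable_seqs.
by move=> h hf n; apply: AP => x xA; apply: hf; exists n.
Qed.

Lemma open_finite_coordinates (U : set HT) (h : HT) : open U -> U h ->
  exists A : seq X, forall k : HT, (forall x, x \in A -> val k x = val h x) -> U k.
Proof.
move=> oU Uh; have : nbhs h U by apply: open_nbhs_nbhs.
move=> /ptws_nbhsP[A [W [hW WU]]]; exists A => k kh; apply: WU => x xA.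
by rewrite kh//; exact: nbhs_singleton.
Qed.

(** Near a point [f] of the closure of [U], members [h] of [U] that agree with
    [f] better and better on growing finite sets may be reset to [f] outside the
    finite set that keeps them in [U]; the resulting sequence converges to
    [f] at every point. *)
Lemma finite_change_kfu : kappa_frechet_urysohn HT.
Proof.
move=> U f oU cf.
have /choice[step stepP] (p : seq X * nat) : exists q : HT * seq X,
    [/\ forall x, x \in p.1 -> d (val f x) (val q.1 x) < p.2.+1%:R^-1,
        {subset p.1 <= q.2} &
        forall k : HT, (forall x, x \in q.2 -> val k x = val q.1 x) -> U k].
  have fN : nbhs f [set h : HT | forall x, x \in p.1 ->
      d (val f x) (val h x) < p.2.+1%:R^-1].
    apply/ptws_nbhsP; exists p.1, (fun x => [set z | d (val f x) z < p.2.+1%:R^-1]).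
    by split=> // x; exact: metric_ball_nbhs.
  have [h [Uh fh]] := cf _ fN; have [A AU] := open_finite_coordinates oU Uh.
  exists (h, p.1 ++ A); split=> //=.
    by move=> x xp; rewrite mem_cat xp.
  by move=> k kh; apply: AU => x xA; apply: kh; rewrite mem_cat xA orbT.
pose S := fix S n := if n is m.+1 then (step (S m, m)).2 else [::].
have S_incr m n : (m <= n)%N -> {subset S m <= S n}.
  elim: n => [|n IH]; first by rewrite leqn0 => /eqP ->.
  rewrite leq_eqVlt => /orP[/eqP -> //|/IH mn x /mn xn].
  by have [_ + _] := stepP (S n, n); apply.
pose h n := (step (S n, n)).1.
pose u n x := if x \in S n.+1 then val (h n) x else val f x.
have Hu n : H (u n).
  apply: (HF (f := val f) (A := S n.+1)); first exact: set_valP.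
  by move=> x /negbTE; rewrite /u => ->.
exists (fun n => ptws_sub (Hu n)); split.
  move=> n; have [_ _] := stepP (S n, n); apply => x xS /=.
  by rewrite /u /= xS.
apply/ptws_cvg_seqP => x /=.
have [[m xm]|nx] := pselect (exists m, x \in S m); last first.
  rewrite (_ : (fun n => u n x) = fun=> val f x); first exact: cvg_cst.
  by apply/funext => n; rewrite /u ifN//; apply/negP => xn; apply: nx; exists n.+1.
move=> V /(metric_nbhsP dM)[N NV]; exists (maxn m N) => // n /=.
rewrite geq_max => /andP[mn Nn]; apply: NV.
rewrite /u (S_incr _ _ (leqW mn) _ xm).
have [+ _ _] := stepP (S n, n) => /(_ x (S_incr _ _ mn _ xm)) /lt_le_trans; apply.
exact: natSinv_le.
Qed.

Variable g : nat -> Y.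
Hypothesis sepg : separated g.
Hypothesis HC : forall y, H (cst y).

Let hY : hausdorff_space Y := metric_hausdorff dM.
Let g01 : g 0 <> g 1. Proof. by move/(separated_inj sepg). Qed.

Let cstH y : HT := ptws_sub (HC y).

Let change_cst (s : seq X) (k : X -> Y) y : HT :=
  ptws_sub (HF (h := fun x => if x \in s then k x else y) (HC y)
    (fun x (xs : x \notin s) => ifN _ _ xs)).

(** The constant [g 1] is in the closure of the finite changes of the constant
    [g 0], but countably many of these together move countably many coordinates
    only. *)
Lemma tight_countable : countable_tightness HT -> countable [set: X].
Proof.
move=> tH; apply: contrapT => nX.
pose A := [set h : HT | exists s : seq X, forall x, x \notin s -> val h x = g 0].
have [|B [cB BA cl]] := tH A (cstH (g 1)).
  move=> U /ptws_nbhsP[s [W [gW WU]]].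
  exists (change_cst s (fun=> g 1) (g 0)); split.
    by exists s => x xs /=; rewrite ifN.
  by apply: WU => x xs /=; rewrite xs; exact: nbhs_singleton (gW x).
have /choice[s sP] h : exists s : seq X, B h -> forall x, x \notin s -> val h x = g 0.
  have [Bh|] := pselect (B h); last by exists [::].
  by have [s sh] := BA _ Bh; exists s.
have [x nx] := uncountable_ex nX (countable_seqs s cB).
have : nbhs (cstH (g 1)) [set h : HT | val h x <> g 0].
  have /(@eval_continuous _ _ _ x (cstH (g 1))) // :=
    hausdorff_neq_nbhs hY (nesym g01).
move=> /cl[h [Bh]]; apply; apply: sP => //.
by apply/negP => xh; apply: nx; exists h.
Qed.

Lemma sigma_countable : sigma_space HT -> countable [set: X].
Proof.
move=> sH; apply: contrapT => nX.
have [U fU Uf] := sigma_points_Gdelta (ptws_hausdorff hY) sH (cstH (g 0)).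
have [D cD DU] := nbhs_countable_coordinates fU.
have [x nx] := uncountable_ex nX cD.
have : change_cst [:: x] (fun=> g 1) (g 0) = cstH (g 0).
  apply: Uf; apply: DU => y Dy /=; rewrite mem_seq1.
  by case: eqP => // yx; move: Dy; rewrite yx.
move=> /(congr1 val)/(congr1 (@^~ x)); rewrite /= mem_head => /esym.
exact: g01.
Qed.

(** Number a countable family at the point [cst (g 0)], and let [E k] collect the
    coordinates at which no function of the k-th member takes the value [g 1].
    There are disjoint finite sets of coordinates, the n-th of which meets each
    infinite [E k] with [k <= n]. Functions that are [g 1] on these sets and
    [g 0] elsewhere converge to [cst (g 0)] but eventually leave every member
    with infinite [E k]; so every coordinate lies in a finite [E k]. *)
Lemma cs_star_countable : countable_cs_star_character HT -> countable [set: X].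
Proof.
move=> /(_ (cstH (g 0)))[N cN NP].
have [idx idx_inj] := countable_injP _ cN.
pose V x := [set h : HT | val h x <> g 1].
have nV x : nbhs (cstH (g 0)) (V x).
  by have /(@eval_continuous _ _ _ x (cstH (g 0))) := hausdorff_neq_nbhs hY g01.
pose E k := [set x | exists A, [/\ N A, idx A = k & A `<=` V x]].
have /choice[pick pickP] (p : seq X * nat) : exists l : seq X,
    (forall x, x \in l -> x \notin p.1) /\
    (infinite_set (E p.2) -> exists2 x, x \in l & E p.2 x).
  have [iE|] := pselect (infinite_set (E p.2)); last by exists [::].
  have [t [ut st tE]] := infinite_uniq_seq (size p.1).+1 iE.
  have [x xt xp] : exists2 x, x \in t & x \notin p.1.
    apply: contrapT => h; have /(uniq_leq_size ut) : {subset t <= p.1}.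
      by move=> x xt; apply: contrapT => /negP xp; apply: h; exists x.
    by rewrite st ltnn.
  exists [:: x]; split=> [y|_]; first by rewrite inE => /eqP ->.
  by exists x; rewrite ?mem_head//; exact: tE.
pose F s n := flatten [seq pick (s, k) | k <- iota 0 n.+1].
pose S := fix S n := if n is m.+1 then S m ++ F (S m) m else [::].
have S_incr m n : (m <= n)%N -> {subset S m <= S n}.
  elim: n => [|n IH]; first by rewrite leqn0 => /eqP ->.
  rewrite leq_eqVlt => /orP[/eqP -> //|/IH mn x /mn xn].
  by rewrite /= mem_cat xn.
have F_S n x : x \in F (S n) n -> x \notin S n.
  by move=> /flatten_mapP[k _]; have [+ _] := pickP (S n, k); apply.
pose u n := change_cst (F (S n) n) (fun=> g 1) (g 0).
have ucvg : u @ \oo --> cstH (g 0).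
  apply/ptws_cvg_seqP => x /=.
  have [[m xm]|nx] := pselect (exists m, x \in F (S m) m); last first.
    rewrite (_ : (fun n => _) = fun=> g 0); first exact: cvg_cst.
    by apply/funext => n; rewrite ifN//; apply/negP => xn; apply: nx; exists n.
  apply: cvg_near_cst; exists m.+1 => // n /= mn; rewrite ifN//.
  apply/negP => /F_S/negP; apply; apply: S_incr mn _ _.
  by rewrite /= mem_cat xm orbT.
apply: (@sub_countable _ _ _ (\bigcup_(k in [set k | finite_set (E k)]) E k)); last first.
  by apply: bigcup_countable => // k fk; exact: finite_set_countable.
apply: subset_card_le => x _.
have [A [NA _ AV iA]] := NP u (V x) ucvg (nV x).
exists (idx A); last by exists A.
apply: contrapT => iE; have [n [/= An kn]] : exists n, A (u n) /\ (idx A <= n)%N.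
  apply: contrapT => h; apply: iA; apply: sub_finite_set (finite_II (idx A)) => n An /=.
  by rewrite ltnNge; apply/negP => kn; apply: h; exists n.
have [_ /(_ iE)[y yl [A' [NA' A'A AV']]]] := pickP (S n, idx A).
have AA' : A' = A by apply: idx_inj => //; exact: mem_set.
rewrite AA' in AV'; apply: (AV' _ An) => /=; rewrite ifT//.
by apply/flatten_mapP; exists (idx A) => //; rewrite mem_iota.
Qed.

(** The number of exceptional points grows with the index of the common value:
    each set is closed, while the union accumulates at [cst (g 0)]. *)
Let sparse n := [set h : HT | (forall x, val h x = g 0 \/ val h x = g n.+1) /\
  forall s : seq X, uniq s -> (forall x, x \in s -> val h x = g 0) -> (size s <= n)%N].

Let g_neq m n : m <> n -> g m <> g n.
Proof. by move=> mn /(separated_inj sepg). Qed.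

Let sparse_closed n : closed (sparse n).
Proof.
move=> h ch; split.
  move=> x; have /(_ (val h x)) := @separated_closed _ _ hY sepg [set 0; n.+1]%N.
  move=> [W hW|_ [->|->] <-]; [|by left|by right].
  have [k [[kx _] /= Wk]] := ch _ (@eval_continuous _ _ _ x h W hW).
  exists (val k x); split=> //.
  by have [->|->] := kx x; [exists 0%N; [left|]|exists n.+1; [right|]].
move=> s us hs; have /ch[k [[k0 ks] /= hk]] :
    nbhs h [set k | forall x, x \in s -> val k x <> g n.+1].
  apply/ptws_nbhsP; exists s, (fun x => if x \in s then [set z | z <> g n.+1] else setT).
  split=> [x|k hk x xs]; last by have := hk x xs; rewrite xs.
  case: ifPn => [xs|_]; last exact: filterT.
  by rewrite hs//; apply: hausdorff_neq_nbhs => //; exact: g_neq.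
by apply: ks => // x xs; have [//|] := k0 x; move/hk: xs.
Qed.

(** A compact set meets only finitely many of the sets [sparse n]: its elements
    are bounded, in terms of the indices of [g], by one bound on infinitely many
    coordinates. *)
Lemma k_space_countable : k_space HT -> countable [set: X].
Proof.
move=> kH; apply: contrapT => nX.
have iX : infinite_set [set: X] by move=> /finite_set_countable.
pose A := \bigcup_n sparse n.
have [|K cK] := kH A.
  move=> cA; suff [n _ [_ h0]] : A (cstH (g 0)).
    have [t [ut st _]] := infinite_uniq_seq n.+1 iX.
    by have := h0 t ut (fun _ _ => erefl); rewrite st ltnn.
  apply: cA => U /ptws_nbhsP[s [W [gW WU]]].
  exists (change_cst s (fun=> g 0) (g (size s).+1)); split; last first.
    by apply: WU => x xs /=; rewrite xs; exact: nbhs_singleton (gW x).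
  exists (size s) => //; split=> [x /=|t ut h0]; first by case: ifP; [left|right].
  apply: uniq_leq_size => // x xt; have := h0 x xt; rewrite /=.
  by case: ifP => // _ /(separated_inj sepg).
apply; apply: closed_subspaceW.
have /choice[M MP] x : exists M, forall k n, K k -> val k x = g n -> (n < M)%N.
  have cKx : compact ((fun k : HT => val k x) @` K).
    apply: continuous_compact => //; apply: continuous_subspaceT.
    exact: eval_continuous.
  have [M MP] := separated_compact sepg cKx; exists M => k n Kk kx.
  by apply: MP; exists k.
have [m im] : exists m, infinite_set [set x | (M x <= m)%N].
  apply: contrapT => /forallNP h; apply: nX.
  apply: (@sub_countable _ _ _ (\bigcup_m [set x | (M x <= m)%N])).
    by apply: subset_card_le => x _; exists (M x) => /=.
  by apply: bigcup_countable => // m _; apply: finite_set_countable; exact: contrapT.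
have KA : K `&` A = K `&` \bigcup_(n in `I_m) sparse n.
  rewrite predeqE => k; split=> -[Kk [n]]; last by move=> _ kn; split=> //; exists n.
  move=> _ [k0 ks]; split=> //; exists n; last by split.
  have [t [ut st tm]] := infinite_uniq_seq n.+1 im.
  have [x xt kx] : exists2 x, x \in t & val k x = g n.+1.
    apply: contrapT => h; have : (size t <= n)%N.
      apply: ks => // x xt; have [//|kx] := k0 x.
      by exfalso; apply: h; exists x.
    by rewrite st ltnn.
  exact: leq_trans (ltnW (MP x k n.+1 Kk kx)) (tm x xt).
rewrite KA; apply: closedI; first by apply: compact_closed => //; exact: ptws_hausdorff.
by apply: closed_bigcup => // n _; exact: sparse_closed.
Qed.

(** Members of the covers around [cst (g 0)] control countably many coordinates
    only. Moving another coordinate along [g] stays in all these members, and a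
    cluster point would give one of [g]. *)
Lemma complete_covers_countable C : @complete_cover_sequence HT C ->
  countable [set: X].
Proof.
move=> [oC CT CF]; apply: contrapT => nX.
have /choice[U UP] n : exists U, C n U /\ U (cstH (g 0)).
  by have [U] := CT n (cstH (g 0)); exists U.
have [n|D cD DU] := @nbhs_countable_coordinates (cstH (g 0)) U.
  have [CU U0] := UP n; apply: open_nbhs_nbhs; split=> //; exact: oC CU.
have [x nx] := uncountable_ex nX cD.
pose u n := change_cst [:: x] (fun=> g n) (g 0).
have [n|h hu] := CF (u @ \oo) _.
  exists (U n); first by have [] := UP n.
  exists 0%N => // k _; apply: DU => y Dy /=; rewrite mem_seq1 ifN//.
  by apply/eqP => yx; apply: nx; rewrite -yx.
apply: (@separated_no_cluster _ _ sepg id (val h x)) => // A B uA hB.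
have [k [/= Ak Bk]] : [set k : HT | A (val k x)] `&` [set k : HT | B (val k x)] !=set0.
  apply: hu; last exact: eval_continuous hB.
  by case: uA => N _ NA; exists N => // n Nn; rewrite /= mem_head; exact: NA.
by exists (val k x).
Qed.

(** For an [H] containing the second Baire class this is
    [baire2_countable_change]. *)
Hypothesis HD : forall (D : set X) (k : X -> Y) y, countable D ->
  H (fun x => if x \in D then k x else y).

Let change_cst_on (D : set X) (cD : countable D) (k : X -> Y) y : HT :=
  ptws_sub (HD k y cD).

(** A function into the range of [g] on an uncountable set repeats a value, so
    [H] is covered by the open sets that witness a repetition at two given
    coordinates, and the set of functions that leave the range of [g]. Countably
    many of these sets mention countably many coordinates, and miss a function
    that is injective there. *)
Lemma lindelof_countable : lindelof_space HT -> countable [set: X].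
Proof.
move=> lH; apply: contrapT => nX.
have /choice[V VP] n : exists V, [/\ open V, V (g n) & forall m, V (g m) -> m = n].
  have [Q gQ sQ] := sepg (g n); exists Q^°; split; [exact: open_interior|exact: gQ|].
  by move=> m /interior_subset Qm; apply: sQ => //; exact: nbhs_singleton.
pose W0 := \bigcup_x [set h : HT | (~` range g) (val h x)].
pose W (p : X * X * nat) :=
  [set h : HT | V p.2 (val h p.1.1)] `&` [set h : HT | V p.2 (val h p.1.2)].
pose C := W0 |` [set W p | p in [set p | p.1.1 <> p.1.2]].
have oW x (Q : set Y) : open Q -> open [set h : HT | Q (val h x)].
  by move=> oQ; have /continuousP := @eval_continuous _ _ H x; apply.
have [||C' [cC' C'C C'T]] := lH C.
- move=> _ [->|[p _ <-]].
    apply: bigcup_open => x _; apply: oW; apply: closed_openC.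
    exact: separated_closed.
  by apply: openI; apply: oW; have [] := VP p.2.
- rewrite predeqE => h; split=> // _.
  have [[x hx]|h0] := pselect (exists x, ~ range g (val h x)).
    by exists W0; [left|exists x].
  have /choice[j jP] x : exists n, g n = val h x.
    apply: contrapT => nj; apply: h0; exists x => -[n _ hn].
    by apply: nj; exists n.
  have [[[x y] /= xy jxy]|nxy] := pselect (exists2 p : X * X, p.1 <> p.2 & j p.1 = j p.2).
    exists (W (x, y, j x)); first by right; exists (x, y, j x).
    have [_ Vx _] := VP (j x).
    by split; rewrite /= -jP -?jxy.
  exfalso; apply: nX; apply/countable_injP; exists j => x y _ _ jxy.
  by apply: contrapT => xy; apply: nxy; exists (x, y).
have /choice[p pP] U : exists p : X * X * nat,
    C' U -> U <> W0 -> U = W p /\ p.1.1 <> p.1.2.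
  have [CU|] := pselect (C' U); last first.
    have [x _] : [set: X] !=set0.
      by apply/set0P/eqP => X0; apply: nX; rewrite X0; exact: countable0.
    by exists (x, x, 0%N).
  have [->|[q qn <-]] := C'C _ CU; last by exists q.
  have [x _] : [set: X] !=set0.
    by apply/set0P/eqP => X0; apply: nX; rewrite X0; exact: countable0.
  by exists (x, x, 0%N).
pose D := \bigcup_(U in C') [set x | x \in [:: (p U).1.1; (p U).1.2]].
have cD : countable D by exact: countable_seqs.
have [idx idx_inj] := countable_injP _ cD.
pose h := change_cst_on cD (fun x => g (idx x)) (g 0).
have hD x : D x -> val h x = g (idx x) by move=> Dx; rewrite /= ifT//; exact: mem_set.
have : [set: HT] h by [].
rewrite -C'T => -[U CU Uh].
have [UW|/(pP U CU)[UW pn]] := pselect (U = W0).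
  move: Uh; rewrite UW => -[x _]; apply => /=.
  by case: ifP => _; [exists (idx x)|exists 0%N].
have D1 : D (p U).1.1 by exists U => //=; rewrite mem_head.
have D2 : D (p U).1.2 by exists U => //=; rewrite !inE eqxx orbT.
have [V1 V2] : V (p U).2 (val h (p U).1.1) /\ V (p U).2 (val h (p U).1.2).
  by move: Uh; rewrite {1}UW => -[].
rewrite !hD// in V1 V2.
have [_ _ Vg] := VP (p U).2.
by apply: pn; apply: idx_inj; [exact: mem_set|exact: mem_set|rewrite (Vg _ V1) (Vg _ V2)].
Qed.

Let injective_but i := [set h : HT | (forall x, range g (val h x)) /\
  forall n x y, n <> i -> val h x = g n -> val h y = g n -> x = y].

Let injective_but_closed i : closed (injective_but i).
Proof.
move=> h ch; split=> [x|n x y ni hx hy].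
  apply: (@separated_closed _ _ hY sepg setT) => W hW.
  have [k [[kx _] Wk]] := ch _ (@eval_continuous _ _ _ x h W hW).
  by exists (val k x); split=> //; exact: kx.
have [Q gQ sQ] := sepg (g n).
have Qx : nbhs h [set k : HT | Q (val k x)] by apply: eval_continuous; rewrite hx.
have Qy : nbhs h [set k : HT | Q (val k y)] by apply: eval_continuous; rewrite hy.
have [k [[kr kn] [/= Qkx Qky]]] := ch _ (filterI Qx Qy).
have kz z : Q (val k z) -> val k z = g n.
  have [m _ <-] := kr z => Qm; congr g; apply: sQ => //; exact: nbhs_singleton.
by apply: (kn n) => //; exact: kz.
Qed.

(** Stone's argument: the closed sets [injective_but 0] and [injective_but 1]
    are disjoint over an uncountable domain, yet they have no disjoint
    neighbourhoods. Given a neighbourhood [C] of the first set, finite sets of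
    coordinates are chosen one after the other such that [C] contains every
    function that numbers the n-th set injectively and is [g 0] on the rest of
    the (n+1)-st. The function that numbers the union injectively and is [g 1]
    elsewhere belongs to the second set and to the closure of [C]. *)
Lemma normal_countable : normal_space HT -> countable [set: X].
Proof.
move=> nH; apply: contrapT => nX.
have P01 h : injective_but 0 h -> ~ injective_but 1 h.
  move=> [h0 h0n] [_ h1n]; apply: nX.
  have /choice[j jP] x : exists n, g n = val h x by have [n _] := h0 x; exists n.
  apply/countable_injP; exists j => x y _ _ jxy.
  have [j0|j0] := pselect (j x = 0).
    by apply: (h1n (j x)); rewrite ?j0// -?jP ?jxy// -?jxy ?j0.
  by apply: (h0n (j x)); rewrite // -?jP ?jxy.
have [|C PC CP] := nH _ (@injective_but_closed 0) (~` injective_but 1).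
  move=> h h0; apply: open_nbhs_nbhs; split; last exact: P01.
  by apply: closed_openC; exact: injective_but_closed.
(* the shift by two keeps the values clear of [g 0] and [g 1] *)
pose f (s : seq X) := change_cst s (fun x => g (index x s).+2) (g 0).
have f0 s : injective_but 0 (f s).
  split=> [x|n x y n0] /=.
    by case: ifP => _; [exists (index x s).+2|exists 0%N].
  case: ifP => [xs|_]; last by move/(separated_inj sepg)/esym.
  case: ifP => [ys|_]; last by move=> _ /(separated_inj sepg)/esym.
  move=> <- /(separated_inj sepg)[] yx.
  by rewrite -(nth_index x xs) -yx nth_index.
have /choice[A AP] s : exists A : seq X, forall k : HT,
    (forall x, x \in A -> val k x = val (f s) x) -> C k.
  have /ptws_nbhsP[A [W [fW WC]]] := PC _ (f0 s); exists A => k kf; apply: WC => x xA.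
  by rewrite kf//; exact: nbhs_singleton.
pose S := fix S n := if n is m.+1 then S m ++ A (S m) else [::].
have S_incr m n : (m <= n)%N -> exists t, S n = S m ++ t.
  elim: n => [|n IH]; first by rewrite leqn0 => /eqP ->; exists [::].
  rewrite leq_eqVlt => /orP[/eqP ->|/IH[t St]]; first by exists [::]; rewrite cats0.
  by exists (t ++ A (S n)); rewrite catA -St.
have S_index m n x : x \in S m -> x \in S n -> index x (S m) = index x (S n).
  wlog mn : m n / (m <= n)%N => [hw|xm _].
    by case/orP: (leq_total m n) => mn; [|move=> xm xn; apply/esym]; exact: hw.
  by have [t ->] := S_incr _ _ mn; rewrite index_cat xm.
pose D := \bigcup_n [set x | x \in S n].
have cD : countable D by exact: countable_seqs.
have /choice[j jP] x : exists i, forall n, x \in S n -> i = index x (S n).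
  have [[n xn]|nx] := pselect (exists n, x \in S n).
    by exists (index x (S n)) => m xm; exact: S_index.
  by exists 0%N => n xn; case: nx; exists n.
have S_le m n x : (m <= n)%N -> x \in S m -> x \in S n.
  by move=> /S_incr[t ->]; rewrite mem_cat => ->.
have j_inj x y : D x -> D y -> j x = j y -> x = y.
  move=> [m _ /= xm] [n _ /= yn]; set M := maxn m n.
  have xM : x \in S M by apply: S_le xm; rewrite leq_maxl.
  have yM : y \in S M by apply: S_le yn; rewrite leq_maxr.
  by rewrite (jP x M)// (jP y M)// => xy; rewrite -(nth_index x xM) xy nth_index.
pose h := change_cst_on cD (fun x => g (j x).+2) (g 1).
have h1 : injective_but 1 h.
  split=> [x|n x y n1] /=.
    by case: ifP => _; [exists (j x).+2|exists 1%N].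
  case: ifP => [/set_mem xD|_]; last by move/(separated_inj sepg)/esym.
  case: ifP => [/set_mem yD|_]; last by move=> _ /(separated_inj sepg)/esym.
  by move=> <- /(separated_inj sepg)[] yx; apply: j_inj.
apply: (CP h) h1 => U /ptws_nbhsP[B [W [hW WU]]].
have [n Bn] : exists n, forall x, x \in B -> D x -> x \in S n.
  elim: B {WU} => [|b B [n Bn]]; first by exists 0%N.
  have [[m _ bm]|nb] := pselect (D b).
    exists (maxn m n) => x; rewrite inE => /orP[/eqP ->|xB] Dx.
      by apply: S_le bm; rewrite leq_maxl.
    by apply: S_le (Bn x xB Dx); rewrite leq_maxr.
  exists n => x; rewrite inE => /orP[/eqP ->//|]; exact: Bn.
pose w := change_cst (S n.+1) (val (f (S n))) (g 1).
exists w; split.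
  by apply: (AP (S n)) => x xA /=; rewrite mem_cat xA orbT.
apply: WU => x xB; suff -> : val w x = val h x by exact: nbhs_singleton.
rewrite /= mem_cat; have [xD|xD] := boolP (x \in D).
  have xn := Bn x xB (set_mem xD).
  by rewrite xn /= (jP x n).
rewrite ifN// -mem_cat; apply/negP => xn; move/negP: xD; apply; apply/mem_set.
by exists n.+1.
Qed.

End FiniteChange.

(** * Metrizable abelian groups *)

Section Group.
Variables (R : realType) (G : topologicalZmodType) (d : G -> G -> R).
Hypothesis dM : metrizes d.

Lemma sub_nbhs (a b : G) (U : set G) : nbhs (a - b) U ->
  exists A B, [/\ nbhs a A, nbhs b B & forall x y, A x -> B y -> U (x - y)].
Proof.
move=> /(@sub_continuous G (a, b))[[A B] [/= aA bB] AB].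
by exists A, B; split=> // x y Ax By; exact: (AB (x, y)).
Qed.

Lemma add_nbhs (a b : G) (U : set G) : nbhs (a + b) U ->
  exists A B, [/\ nbhs a A, nbhs b B & forall x y, A x -> B y -> U (x + y)].
Proof.
move=> /(@add_continuous G (a, b))[[A B] [/= aA bB] AB].
by exists A, B; split=> // x y Ax By; exact: (AB (x, y)).
Qed.

Lemma translate_nbhs (a : G) (U : set G) : nbhs a U -> nbhs 0 [set t | U (a + t)].
Proof.
rewrite -[a in nbhs a](addr0 a) => /add_nbhs[A [B [aA bB AB]]].
by apply: filterS bB => t Bt; apply: AB => //; exact: nbhs_singleton.
Qed.

Lemma sub_small (a : G) (U : set G) : nbhs 0 U ->
  exists2 A, nbhs a A & forall x y, A x -> A y -> U (x - y).
Proof.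
rewrite -(subrr a) => /sub_nbhs[A [B [aA aB AB]]].
by exists (A `&` B); [exact: filterI|move=> x y [Ax _] [_ By]; exact: AB].
Qed.

(** Each point is chosen outside the translates of a neighbourhood of zero by the
    previous ones. *)
Lemma not_precompact_separated : ~ precompact_group G ->
  exists g : nat -> G, separated g.
Proof.
move=> /existsNP[U /not_implyP[U0 hU]].
have /choice[step stepP] (s : seq G) : exists y, forall a, a \in s -> ~ U (y - a).
  apply: contrapT => /forallNP h; apply: hU; exists [set` s]; first exact: finite_seq.
  rewrite predeqE => y; split=> // _.
  have /existsNP[a /not_implyP[sa /contrapT Uya]] := h y.
  by exists a => //; exists (y - a) => //; rewrite addrC subrK.
pose S := fix S n := if n is m.+1 then step (S m) :: S m else [::].
pose g n := step (S n).
have gS m n : (m < n)%N -> g m \in S n.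
  elim: n => // n IH; rewrite ltnS leq_eqVlt => /orP[/eqP ->|/IH mn].
    exact: mem_head.
  by rewrite /= inE mn orbT.
exists g => y; have [A yA AU] := sub_small y U0; exists A => // m n Am An.
by apply: contrapT => /eqP; rewrite neq_ltn => /orP[]/gS /stepP; apply; exact: AU.
Qed.

Lemma cauchy_small (F : set_system G) (U : set G) : Filter F ->
  (F, F) --> @group_entourage G -> nbhs 0 U ->
  exists2 A, F A & forall x y, A x -> A y -> U (x - y).
Proof.
move=> FF cF U0.
have /cF [[A B] [/= FA FB] AB] : @group_entourage G [set p | U (p.1 - p.2)].
  by exists U.
by exists (A `&` B); [exact: filterI|move=> x y [Ax _] [_ By]; exact: (AB (x, y))].
Qed.

(** If a Cauchy filter [F] had a limit [c] only in the completion, then [G] and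
    [G + c] would be two disjoint dense sets of type G-delta there. The Baire
    category argument is carried out inside [G]: a state [(b, O, P)] stands for
    open sets [O] and [P] such that [b \in P] and [b + c] belongs to [O]. Along a
    shrinking sequence of states, [O] closes in on a point [z] and [P] on a point
    [w] with [c = z - w]. *)
Lemma complete_covers_group C : @complete_cover_sequence G C -> complete_group G.
Proof.
move=> [oC CT CF] F PF cF.
pose state : Type := G * set G * set G.
pose valid (s : state) := [/\ open s.1.2, open s.2, s.2 s.1.1 &
  F [set c | s.1.2 (c + s.1.1)]].
pose small n (V W : set G) := [/\ W `<=` V, exists2 U, C n U & W `<=` U &
  forall x y, W x -> W y -> d x y < n.+1%:R^-1].
have shrink n (V : set G) z : open V -> V z ->
    exists W, [/\ open W, W z & small n V W].
  move=> oV Vz; have [U CU Uz] := CT n z.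
  have e2 : 0 < n.+1%:R^-1 / 2 :> R by rewrite divr_gt0.
  exists (V `&` U `&` [set y | d z y < n.+1%:R^-1 / 2]); split.
  - apply: openI; last exact: metric_ball_open.
    by apply: openI => //; exact: oC CU.
  - by split=> //=; case: dM => d0 _ _ _; rewrite (proj2 (d0 z z) erefl).
  - split; first by move=> y [[]].
      by exists U => // y [[]].
    move=> x y [_ /= zx] [_ /= zy]; case: dM => _ dC dT _.
    by rewrite (le_lt_trans (dT x z y))// [ltRHS]splitr ltrD// dC.
have /choice[step stepP] (p : state * nat) : exists t : state, valid p.1 ->
    [/\ valid t, small p.2 p.1.1.2 t.1.2 & small p.2 p.1.2 t.2].
  case: p => -[[b V] W] n /=.
  have [[/= oV oW Wb FV]|] := pselect (valid (b, V, W)); last by exists (b, V, W).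
  have bW : nbhs b W by apply: open_nbhs_nbhs.
  (* [a + b] is the next point of [V] near [b + c]; moving [b] by [a - a'], with
     [a'] much closer to [c] than [a], keeps [b + c] in the shrunken [V1] *)
  have [A FA AW] := cauchy_small PF cF (translate_nbhs bW).
  have [a [Aa /= Va]] := filter_ex (filterI FA FV).
  have [V1 [oV1 V1a sV1]] := shrink n _ _ oV Va.
  have aV : nbhs (a + b) V1 by apply: open_nbhs_nbhs.
  have [A' FA' AV] := cauchy_small PF cF (translate_nbhs aV).
  have [a' [Aa' A'a']] := filter_ex (filterI FA FA').
  have Wb1 : W (b + (a - a')) by exact: AW.
  have [W1 [oW1 W1b sW1]] := shrink n _ _ oW Wb1.
  exists (b + (a - a'), V1, W1) => _; split=> //; split=> //=.
  apply: filterS FA' => c A'c /=.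
  have -> : c + (b + (a - a')) = (a + b) + (c - a').
    by rewrite (addrCA (a + b)) (addrA b) (addrC b).
  exact: AV.
pose s := fix s n : state := if n is m.+1 then step (s m, m) else (0, setT, setT).
have sv n : valid (s n).
  elim: n => [|n IH]; last by have [] := stepP (s n, n) IH.
  by split => //=; [exact: openT|exact: openT|exact: filterT].
have sP n : small n (s n).1.2 (s n.+1).1.2 /\ small n (s n).2 (s n.+1).2.
  by have [] := stepP (s n, n) (sv n).
have lim (V : nat -> set G) : (forall n, V n !=set0) ->
    (forall n, small n (V n) (V n.+1)) ->
    exists z : G, forall U, nbhs z U -> exists N, forall n, (N <= n)%N -> V n `<=` U.
  move=> V0 sV.
  have Vd m n : (m <= n)%N -> V n `<=` V m.
    elim: n => [|n IH]; first by rewrite leqn0 => /eqP ->.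
    rewrite leq_eqVlt => /orP[/eqP -> //|/IH]; apply: subset_trans.
    by have [] := sV n.
  pose E := filter_from [set: nat] V.
  have PE : ProperFilter E.
    apply: filter_from_proper => //; apply: filter_from_filter; first by exists 0%N.
    move=> m n _ _; exists (maxn m n) => // z Vz.
    by split; apply: Vd Vz; [exact: leq_maxl|exact: leq_maxr].
  have [n|z zE] := CF E PE.
    by have [_ [U CU VU] _] := sV n; exists U => //; exists n.+1.
  exists z => U; case: (dM) => _ _ dT dn /dn[e e0 eU].
  have e2 : 0 < e / 2 by rewrite divr_gt0.
  have [N Ne] := eventually_natSinv_lt e2; exists N.+1 => n Nn y Vy; apply: eU.
  have [||x [Vx /= zx]] := zE (V N.+1) [set x | d z x < e / 2].
  - by exists N.+1.
  - exact: metric_ball_nbhs.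
  rewrite (le_lt_trans (dT z x y))// [ltRHS]splitr ltrD//.
  have [_ _ /(_ _ _ Vx (Vd _ _ Nn _ Vy)) xy] := sV N; exact: lt_trans Ne.
have [||z zV] := lim (fun n => (s n).1.2).
- by move=> n; have [_ _ _ /filter_ex[c]] := sv n; exists (c + (s n).1.1).
- by move=> n; have [] := sP n.
have [||w wV] := lim (fun n => (s n).2).
- by move=> n; have [_ _] := sv n; exists (s n).1.1.
- by move=> n; have [] := sP n.
exists (z - w) => U /sub_nbhs[A [B [zA wB AB]]].
have [N NA] := zV A zA; have [M MB] := wV B wB.
pose n := maxn N M; have [_ _ Wb FV] := sv n.
apply: filterS FV => c /= Vc; rewrite -(addrK (s n).1.1 c); apply: AB.
  by apply: NA Vc; exact: leq_maxl.
by apply: MB Wb; exact: leq_maxr.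
Qed.

End Group.

(** * Baire functions *)

(** Intersections of initial segments of a numbered countable base. *)
Lemma first_countable_base (X : topologicalType) (x : X) : first_countable X ->
  exists U : nat -> set X, (forall n, nbhs x (U n)) /\
    forall V, nbhs x V -> exists N, forall n, (N <= n)%N -> U n `<=` V.
Proof.
move=> /(_ x)[B [cB Bx BV]]; have [idx idx_inj] := countable_injP _ cB.
have /choice[W WP] n : exists W, nbhs x W /\ forall V, B V -> idx V = n -> W = V.
  have [[V [BV' Vn]]|h] := pselect (exists V, B V /\ idx V = n).
    exists V; split; first exact: Bx.
    by move=> V' BV'' Vn'; apply: idx_inj; [exact: mem_set|exact: mem_set|rewrite Vn].
  exists setT; split; first exact: filterT.
  by move=> V BV' Vn; exfalso; apply: h; exists V.
pose U := fix U n := if n is m.+1 then U m `&` W m else setT.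
exists U; split.
  elim=> [|n IH]; first exact: filterT.
  by apply: filterI => //; have [] := WP n.
move=> V /BV[V' BV' V'V]; exists (idx V').+1 => n Vn; apply: subset_trans V'V.
have [_ /(_ _ BV' erefl) <-] := WP (idx V').
elim: n Vn => // n IH; rewrite ltnS leq_eqVlt => /orP[/eqP -> y []//|/IH].
by apply: subset_trans => y [].
Qed.

Section Baire.
Variables (X : topologicalType) (G : topologicalZmodType).
Hypothesis hX : hausdorff_space X.
Hypothesis GX : tychonoff_wrt G X.

Let B1 := @baire_class X G 1.

Lemma baire1_cst c : B1 (cst c).
Proof.
exists (fun=> cst c); first by move=> n x; exact: cvg_cst.
by move=> x; exact: cvg_cst.
Qed.

Lemma cvg_add (T : Type) (F : set_system T) (u v : T -> G) a b : Filter F ->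
  u @ F --> a -> v @ F --> b -> (fun t => u t + v t) @ F --> a + b.
Proof.
move=> FF ua vb U /add_nbhs[A [B [aA bB AB]]].
have FAB : F ((u @^-1` A) `&` (v @^-1` B)).
  by apply: filterI; [exact: ua|exact: vb].
by apply: (@filterS _ F) FAB => t [At Bt]; exact: AB.
Qed.

Lemma baire1_add f h : B1 f -> B1 h -> B1 (fun x => f x + h x).
Proof.
move=> [u uc uf] [v vc vh]; exists (fun n x => u n x + v n x).
  by move=> n x; apply: cvg_add; [exact: uc|exact: vc].
by move=> x; exact: cvg_add.
Qed.

(** At a point of first countability the characteristic function of the point is
    the limit of bumps supported in a shrinking neighbourhood base. *)
Lemma baire1_point (fX : first_countable X) x g :
  B1 (fun y => if y == x then g else 0).
Proof.
have [->|/eqP g0] := eqVneq g 0.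
  rewrite (_ : (fun _ => _) = cst 0); first exact: baire1_cst.
  by apply/funext => y; rewrite if_same.
have [U [xU UV]] := first_countable_base x fX.
have /choice[f fP] n : exists f : X -> G,
    [/\ continuous f, f x = g & forall a, (~` (U n)^°) a -> f a = 0].
  apply: GX => //; first by apply: open_closedC; exact: open_interior.
  by apply; exact: xU.
exists f; first by move=> n; have [] := fP n.
move=> y; have [->|/eqP yx] := eqVneq y x.
  rewrite (_ : (fun n => f n x) = fun=> g); first exact: cvg_cst.
  by apply/funext => n; have [] := fP n.
have [N NU] := UV _ (hausdorff_neq_nbhs hX (nesym yx)).
apply: cvg_near_cst; exists N => // n Nn.
have [_ _ ->//] := fP n; move=> /interior_subset /(NU n Nn); exact.
Qed.

(** Finitely many changes are made one at a time, each by adding a function that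
    vanishes off one point. *)
Lemma add_finite_change_closed (P : set (X -> G)) :
  (forall f h, P f -> P h -> P (fun x => f x + h x)) ->
  (forall x g, P (fun y => if y == x then g else 0)) -> finite_change_closed P.
Proof.
move=> Padd Ppt f h A; elim: A h => [|a A IH] h Pf hf.
  by rewrite (_ : h = f)//; apply/funext => x; apply: hf.
have -> : h = fun x => (if x == a then f a else h x) +
    (if x == a then h a - f a else 0).
  apply/funext => x; case: eqP => [->|_]; last by rewrite addr0.
  by rewrite addrC subrK.
apply: Padd => //; apply: IH => // x xA; case: eqP => [->//|/eqP xa].
by apply: hf; rewrite inE negb_or xa.
Qed.

(** The functions changed on finite initial segments of [D] only are of the first
    Baire class. *)
Lemma baire2_countable_change (fX : first_countable X) (D : set X) (k : X -> G) y :
  countable D -> @baire_class X G 2 (fun x => if x \in D then k x else y).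
Proof.
move=> cD; have [idx idx_inj] := countable_injP _ cD.
exists (fun n x => if (x \in D) && (idx x < n)%N then k x else y).
  move=> n; right; have [A AP] := injective_initial_segment n idx_inj.
  have BF := add_finite_change_closed baire1_add (baire1_point fX).
  apply: (BF _ _ A (baire1_cst y)) => x xA.
  rewrite ifN//; apply/negP => /andP[/set_mem Dx xn].
  by move/negP: xA; apply; apply/AP.
move=> x; have [xD|xD] := boolP (x \in D); last exact: cvg_cst.
by apply: cvg_near_cst; exists (idx x).+1 => // n /= ->.
Qed.

Lemma continuous_interpolation (f : X -> G) (A : seq X) :
  exists g : X -> G, continuous g /\ forall x, x \in A -> g x = f x.
Proof.
elim: A => [|a A [g [cg gf]]].
  by exists (cst 0); split=> // x; exact: cvg_cst.
have [aA|aA] := boolP (a \in A).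
  by exists g; split=> // x; rewrite inE => /orP[/eqP ->|]; exact: gf.
have [fa|/eqP fa] := eqVneq (f a - g a) 0.
  exists g; split=> // x; rewrite inE => /orP[/eqP ->|]; last exact: gf.
  by apply/esym/eqP; rewrite -subr_eq0 fa.
have cA : closed [set` A].
  apply: compact_closed => //; apply: finite_compact; exact: finite_seq.
have [|b [cb ba bA]] := @GX [set` A] a (f a - g a) 0 cA _ fa; first exact/negP.
exists (fun x => g x + b x); split.
  by move=> x; apply: cvg_add; [exact: cg|exact: cb].
move=> x; rewrite inE => /orP[/eqP ->|xA]; first by rewrite ba addrC subrK.
by rewrite bA// addr0; exact: gf.
Qed.

Lemma countable_baire1 (f : X -> G) : countable [set: X] -> B1 f.
Proof.
move=> cX; have [idx idx_inj] := countable_injP _ cX.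
have /choice[g gP] n : exists g : X -> G, continuous g /\
    forall x, (idx x < n)%N -> g x = f x.
  have [A AP] := injective_initial_segment n idx_inj.
  have [g [cg gf]] := continuous_interpolation f A.
  by exists g; split=> // x xn; apply: gf; apply/AP.
exists g; first by move=> n; have [] := gP n.
move=> x; apply: cvg_near_cst; exists (idx x).+1 => // n xn.
by have [_] := gP n; apply.
Qed.

End Baire.

(** * Powers with a countable exponent *)

Section CountablePower.
Variables (R : realType) (X : choiceType).
Hypothesis cX : countable [set: X].

Let countable_idx : exists idx : X -> nat, injective idx.
Proof.
have [idx idx_inj] := countable_injP _ cX; exists idx => x y.
by apply: idx_inj; exact: mem_set.
Qed.

Lemma countable_power_metrizable (Y : topologicalType) (H : set {ptws X -> Y}) :
  [set: X] !=set0 -> metrizable Y R -> metrizable (set_type H) R.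
Proof.
move=> X0 /metrizableP[d dM]; have [idx idx_inj] := countable_idx.
by apply/metrizableP; exists (ptws_dist d idx); exact: ptws_dist_metrizes.
Qed.

(** Values from a countable dense set, read off a finite list that is padded by
    a fixed value. *)
Lemma countable_power_separable (Y : topologicalType) (H : set {ptws X -> Y}) :
  (forall f, H f) -> separable_space Y -> separable_space (set_type H).
Proof.
move=> HT [D cD dD]; have [idx idx_inj] := countable_idx.
have [[y0 _]|nY] := pselect (exists y : Y, True); last first.
  have [[h]|nH] := pselect (inhabited (set_type H)).
    exists [set h]; first exact: countable1.
    move=> V [k Vk] _; exists h; split=> //.
    suff -> : h = k by [].
    by apply/val_inj/funext => x; case: nY; exists (val h x).
  by exists set0 => [|V [h] _]; [exact: countable0|case: nH].
have [num num_inj] := countable_injP _ cD.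
have /choice[q qP] n : exists y, forall z, D z -> num z = n -> y = z.
  have [[z [Dz zn]]|h] := pselect (exists z, D z /\ num z = n); last first.
    by exists y0 => z Dz zn; case: h; exists z.
  exists z => z' Dz' zn'; apply: num_inj; [exact: mem_set|exact: mem_set|].
  by rewrite zn.
pose step (l : seq nat) : set_type H := ptws_sub (HT (fun x => q (nth 0 l (idx x))%N)).
exists (range step).
  by apply: card_le_trans (card_image_le _ _) _; exact: countableP.
move=> V [h Vh] oV; have : nbhs h V by apply: open_nbhs_nbhs.
move=> /ptws_nbhsP[A [W [hW WV]]].
have /choice[r rP] i : exists n, forall x, idx x = i -> W x (q n).
  have [[x xi]|nx] := pselect (exists x, idx x = i); last first.
    by exists 0%N => x xi; case: nx; exists x.
  have [||z [Wz Dz]] := dD (W x)^°; first by exists (val h x); exact: hW.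
    exact: open_interior.
  exists (num z) => x' x'i; rewrite (qP (num z) z)//.
  have -> : x' = x by apply: idx_inj; rewrite x'i.
  exact: interior_subset.
have [N AN] : exists N, forall x, x \in A -> (idx x < N)%N.
  exists (\max_(x <- A) idx x).+1 => x xA; rewrite ltnS.
  exact: leq_bigmax_seq.
exists (step (mkseq r N)); split; last by exists (mkseq r N).
by apply: WV => x xA /=; rewrite nth_mkseq ?AN//; exact: rP.
Qed.

(** The n-th cover makes the first coordinates small, so a filter meeting all of
    the covers is Cauchy, hence convergent, at every coordinate. *)
Lemma countable_power_complete_covers (G : topologicalZmodType) (H : set {ptws X -> G}) :
  (forall f, H f) -> metrizable G R -> complete_group G ->
  exists C, @complete_cover_sequence (set_type H) C.
Proof.
move=> HT /metrizableP[d dM] cG; have [idx idx_inj] := countable_idx.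
pose V n := [set t : G | d 0 t < n.+1%:R^-1].
pose small n (U : set (set_type H)) := forall h k, U h -> U k ->
  forall x, (idx x <= n)%N -> V n (val h x - val k x).
exists (fun n => [set U | open U /\ small n U]); split.
- by move=> n U [].
- move=> n f.
  have /choice[W WP] x : exists W, nbhs (val f x) W /\
      forall y z, W y -> W z -> V n (y - z).
    have Vn : nbhs 0 (V n) by exact: metric_ball_nbhs.
    by have [W fW WV] := sub_small (val f x) Vn; exists W.
  have [A AP] : exists A : seq X, forall x, x \in A <-> [set: X] x /\ (idx x < n.+1)%N.
    by apply: injective_initial_segment => x y _ _; exact: idx_inj.
  pose U := [set h : set_type H | forall x, x \in A -> W x (val h x)].
  exists U^°.
    split; first exact: open_interior.
    move=> h k /interior_subset Uh /interior_subset Uk x xn.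
    have xA : x \in A by apply/AP.
    by have [_] := WP x; apply; [exact: Uh|exact: Uk].
  by apply/ptws_nbhsP; exists A, W; split=> // x; have [] := WP x.
- move=> F PF FC.
  have /choice[l lP] x : exists l : G, (fun h : set_type H => val h x) @ F --> l.
    apply: cG => U [T /(metric_nbhsP dM)[n nT] TU].
    have [B [_ sB] FB] := FC (maxn (idx x) n).
    exists ((fun h : set_type H => val h x) @` B, (fun h : set_type H => val h x) @` B).
      by split; apply: (@filterS _ F _ B) => // h Bh; exists h.
    move=> [_ _] /= [[h Bh <-] [k Bk <-]]; apply: TU; apply: nT.
    have := sB h k Bh Bk x (leq_maxl _ _); rewrite /V /= => /lt_le_trans; apply.
    by rewrite natSinv_le// leq_maxr.
  exists (ptws_sub (HT l)) => A B FA lB.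
  have Fl : F --> ptws_sub (HT l) by apply/ptws_cvgP.
  exact: filter_ex (filterI FA (Fl B lB)).
Qed.

End CountablePower.

(** Evaluation at a point is a left inverse of the embedding of [Y] as the
    constants, and carries cluster points back. *)
Lemma constants_complete_covers (X : choiceType) (Y : topologicalType)
    (H : set {ptws X -> Y}) C : [set: X] !=set0 -> (forall y, H (cst y)) ->
  @complete_cover_sequence (set_type H) C -> exists C', @complete_cover_sequence Y C'.
Proof.
move=> [x _] HC [oC CT CF]; pose c y : set_type H := ptws_sub (HC y).
have cc : continuous c by move=> y; apply/ptws_cvgP => z /=; exact: cvg_id.
exists (fun n => [set c @^-1` U | U in C n]); split.
- by move=> n _ [U CU <-]; move/continuousP: cc; apply; exact: oC CU.
- by move=> n y; have [U CU Uy] := CT n (c y); exists (c @^-1` U) => //; exists U.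
- move=> F PF FC; have [n|h hF] := CF (c @ F) _.
    by have [_ [U CU <-] FU] := FC n; exists U.
  exists (val h x) => A B FA hB.
  have FcA : (c @ F) (c @` A) by apply: (@filterS _ F _ A) => // y Ay; exists y.
  have [_ [[y Ay <-] By]] := hF _ _ FcA (@eval_continuous _ _ _ x h B hB).
  by exists y.
Qed.

Lemma lindelof_image (Z Y : topologicalType) (f : Z -> Y) :
  continuous f -> (forall y, exists z, f z = y) ->
  lindelof_space Z -> lindelof_space Y.
Proof.
move=> cf sf lZ C oC CT.
have [||C' [cC' C'C C'T]] := lZ [set f @^-1` U | U in C].
- by move=> _ [U CU <-]; move/continuousP: cf; apply; exact: oC.
- rewrite predeqE => z; split=> // _; have : [set: Y] (f z) by [].
  by rewrite -CT => -[U CU Uz]; exists (f @^-1` U) => //; exists U.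
have /choice[s sP] V : exists U, C' V -> C U /\ V = f @^-1` U.
  have [/C'C[U CU <-]|] := pselect (C' V); first by exists U.
  by exists set0.
exists (s @` C'); split.
- exact: card_le_trans (card_image_le _ _) cC'.
- by move=> _ [V C'V <-]; have [] := sP V C'V.
rewrite predeqE => y; split=> // _; have [z <-] := sf y.
have : [set: Z] z by []. rewrite -C'T => -[V C'V Vz]; have [_ VE] := sP V C'V.
by exists (s V); [exists V|move: Vz; rewrite {1}VE].
Qed.

(** * The equivalences *)

Theorem theorem1p3 (R : realType) (G : topologicalZmodType)
  (X : topologicalType) (H : set (X -> G))
  (metrG : metrizable G R) (nprecG : ~ precompact_group G)
  (X0 : [set: X] !=set0) (tychX : tychonoff_space X)
  (GtychX : tychonoff_wrt G X) (fcX : first_countable X)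
  (Hsub : zmod_closed [in H]) (HB1 : @baire_class X G 1 `<=` H) :
  let Hp : topologicalType := set_type (H : set {ptws X -> G}) in
  [/\ kappa_frechet_urysohn Hp /\ ascoli_space Hp R,
      [<-> countable [set: X];
           metrizable Hp R /\ H = [set: X -> G];
           countable_tightness Hp;
           countable_cs_star_character Hp;
           sigma_space Hp;
           k_space Hp] /\
      (@baire_class X G 2 `<=` H ->
       [<-> countable [set: X];
            metrizable Hp R /\ H = [set: X -> G];
            countable_tightness Hp;
            countable_cs_star_character Hp;
            sigma_space Hp;
            k_space Hp;
            normal_space Hp]),
      @baire_class X G 2 `<=` H ->
      (lindelof_space Hp <-> countable [set: X] /\ separable_space G) &
      cech_complete Hp <-> countable [set: X] /\ complete_group G].
Proof.
move=> Hp; have [hX _] := tychX; have /metrizableP[d dM] := metrG.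
have [g sepg] := not_precompact_separated nprecG.
have HF : finite_change_closed H.
  apply: add_finite_change_closed; last first.
    by move=> x y; apply: HB1; exact: baire1_point.
  case: Hsub => _ HB f h Hf Hh.
  have H0 : H (cst 0) by apply: HB1; exact: baire1_cst.
  have HN : H (fun x => - h x).
    have := HB _ _ (mem_set H0) (mem_set Hh); move/set_mem.
    by congr H; apply/funext => x; rewrite /= sub0r.
  have := HB _ _ (mem_set Hf) (mem_set HN); move/set_mem.
  by congr H; apply/funext => x; rewrite /= opprK.
have HC y : H (cst y) by apply: HB1; exact: baire1_cst.
have kfu : kappa_frechet_urysohn Hp := finite_change_kfu dM HF.
have HTP : countable [set: X] -> forall f, H f.
  by move=> cX f; apply: HB1; exact: countable_baire1.
have mH : countable [set: X] -> exists dH : Hp -> Hp -> R, metrizes dH.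
  move=> cX; apply/metrizableP; exact: countable_power_metrizable.
have tight := tight_countable dM HF sepg HC.
have h12 : countable [set: X] -> metrizable Hp R /\ H = [set: X -> G].
  move=> cX; split; first by apply/metrizableP; exact: mH.
  by rewrite predeqE => f; split=> // _; exact: HTP.
have h23 : metrizable Hp R /\ H = [set: X -> G] -> countable_tightness Hp.
  by move=> [/metrizableP[dH dHM] _]; exact: metric_countable_tightness dHM.
have h34 : countable_tightness Hp -> countable_cs_star_character Hp.
  by move=> /tight/mH[dH dHM]; exact: metric_cs_star dHM.
have h45 : countable_cs_star_character Hp -> sigma_space Hp.
  move=> /(cs_star_countable dM HF sepg HC)/mH[dH dHM]; exact: metric_sigma dHM.
have h56 : sigma_space Hp -> k_space Hp.
  move=> /(sigma_countable dM HF sepg HC)/mH[dH dHM]; exact: metric_k_space dHM.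
have h61 := k_space_countable dM HF sepg HC.
split.
- by split=> //; exact: kfu_ascoli.
- split; first by tfae.
  move=> HB2; have HD (D : set X) (k : X -> G) y : countable D ->
      H (fun x => if x \in D then k x else y).
    by move=> cD; apply: HB2; exact: baire2_countable_change.
  tfae => //; first by move=> /h61/mH[dH dHM]; exact: metric_normal dHM.
  exact: (@normal_countable R X G H d dM HF g sepg HC HD).
- move=> HB2; have HD (D : set X) (k : X -> G) y : countable D ->
      H (fun x => if x \in D then k x else y).
    by move=> cD; apply: HB2; exact: baire2_countable_change.
  split=> [lH|[cX sG]].
    have cX := lindelof_countable dM sepg HD lH; split=> //.
    apply: (metric_lindelof_separable dM); have [x _] := X0.
    apply: (lindelof_image (@eval_continuous _ _ (H : set {ptws X -> G}) x) _ lH).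
    by move=> y; exists (ptws_sub (HC y)).
  have [dH dHM] := mH cX; apply: (metric_separable_lindelof dHM).
  by apply: countable_power_separable => //; exact: HTP.
- split=> [/cech_complete_covers[C CP]|[cX cG]].
    split; first exact: (complete_covers_countable HF sepg HC CP).
    have [C' C'P] := constants_complete_covers X0 HC CP.
    exact: (@complete_covers_group R G d dM C' C'P).
  have [dH dHM] := mH cX.
  have [C CP] := countable_power_complete_covers cX (HTP cX) metrG cG.
  exact: (@metric_covers_cech_complete R Hp dH dHM C CP).
Qed.
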